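(* Let $X$ be a connected CW-complex with finite $k$-skeleton ($k\ge1$), let $i\le k$, let $H=H_1(X,\mathbb{Z})$, and let $A$ be a quotient of $H$. Then $$\Omega^i_A(X)\subseteq\Gamma(H,A)\setminus\bigcup_{d\ge1}\ \bigcup_{\xi\in\Xi_d(V^i(X))}U_A(\xi).$$
   Context: $\Gamma(H,A)=\operatorname{Epi}(H,A)/\operatorname{Aut}(A)$ is the set of classes $[\nu]$ of epimorphisms $\nu\colon H\twoheadrightarrow A$ modulo composition with automorphisms of $A$. $X^\nu\to X$ is the connected regular cover with deck group $A$ determined by the kernel of $\pi_1(X)\twoheadrightarrow H\xrightarrow{\nu}A$, and $\Omega^i_A(X)=\{[\nu]\in\Gamma(H,A)\mid \dim_{\mathbb{C}}H_j(X^\nu,\mathbb{C})<\infty\text{ for all }0\le j\le i\}$. $\widehat{H}=\operatorname{Hom}(H,\mathbb{C}^* )$, and $V^i(X)=\{\rho\in\widehat{H}\mid H_j(X,\mathbb{C}_\rho)\ne0\text{ for some }1\le j\le i\}$, where $\mathbb{C}_\rho$ is the rank $1$ local system defined by $\rho$. For a subgroup $\xi\le H$, its primitive closure is $\overline{\xi}=\{x\in H\mid mx\in\xi\text{ for some integer }m\geq 1\}$, and $V(\xi)=\operatorname{Hom}(H/\xi,\mathbb{C}^* )\subset\widehat{H}$, an algebraic subgroup with identity component $V(\overline\xi)$. The finite group $\overline\xi/\xi\cong\operatorname{Tors}(H/\xi)$ is a direct summand of $H/\xi$, so, after choosing a splitting, $\widehat{\overline\xi/\xi}$ is viewed as a finite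 subgroup of $V(\xi)\subset\widehat{H}$. For $\eta\in\widehat{\overline\xi/\xi}$ the coset $\eta V(\overline\xi)$ is the set of characters of $H$ whose restriction to $\overline\xi$ is $\eta$, and so does not depend on the splitting. For a subvariety $W\subset\widehat{H}$ and $d\ge1$, $\Xi_d(W)$ is the collection of subgroups $\xi\le H$ such that (1) $\overline\xi/\xi$ is cyclic of order dividing $d$, and (2) there is a generator $\eta$ of $\widehat{\overline\xi/\xi}$ such that $\eta V(\overline\xi)$ is a maximal, positive-dimensional, torsion-translated subtorus in $W$. $U_A(\xi)$ is the set of all $[\nu]\in\Gamma(H,A)$ such that $\operatorname{rank}(\ker(\nu)+\xi)<\operatorname{rank}H$ and $\ker(\nu)\cap\overline\xi\subseteq\xi$. *)

(* Defs.v *)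
From HB Require Import structures.
From mathcomp Require Import all_boot all_order all_algebra.
From mathcomp Require Import ring_quotient.
From mathcomp Require Import all_classical all_reals all_analysis.
From mathcomp Require Import complex.
From mathcomp Require Import freeg.
Set Implicit Arguments.
Unset Strict Implicit.
Unset Printing Implicit Defensive.
Import Order.TTheory GRing.Theory Num.Theory.
Import numFieldNormedType.Exports.
Local Open Scope classical_set_scope.
Local Open Scope ring_scope.

Section Simplices.
Variable R : realType.

Definition simplex n : set 'rV[R]_n.+1 :=
  [set t | (forall i, 0 <= t ord0 i) /\ \sum_i t ord0 i = 1].

Definition Delta n : topologicalType := set_type (@simplex n).

Lemma vertex_subproof n (i : 'I_n.+1) :
  (delta_mx ord0 i : 'rV[R]_n.+1) \in @simplex n.
Proof.
apply/mem_set; split=> [j|]; first by rewrite mxE eqxx /= ler0n.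
by rewrite (bigD1 i) //= big1 ?mxE ?eqxx ?addr0 // => j /negbTE ji;
  rewrite mxE ji andbF.
Qed.

Definition vertex n (i : 'I_n.+1) : Delta n := exist (fun t => t \in @simplex n) _ (vertex_subproof i).

(* The affine map of standard simplices sending vertex i to vertex (f i). *)
Definition push_mx m n (f : 'I_m.+1 -> 'I_n.+1) (t : 'rV[R]_m.+1) :
  'rV[R]_n.+1 := \row_j \sum_(i | f i == j) t ord0 i.

Lemma push_subproof m n (f : 'I_m.+1 -> 'I_n.+1) (t : Delta m) :
  push_mx f (set_val t) \in @simplex n.
Proof.
have [t_ge0 t_sum] : simplex (set_val t) by exact: set_valP.
apply/mem_set; split=> [j|].
  by rewrite mxE sumr_ge0.
under eq_bigr do rewrite mxE.
by rewrite -t_sum [RHS](partition_big f predT).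
Qed.

Definition push m n (f : 'I_m.+1 -> 'I_n.+1) (t : Delta m) : Delta n :=
  exist (fun t => t \in @simplex n) _ (push_subproof f t).

Lemma push_continuous m n (f : 'I_m.+1 -> 'I_n.+1) : continuous (push f).
Proof.
apply: continuous_comp_initial => t.
rewrite (_ : set_val \o _ = push_mx f \o set_val); last first.
  by apply/funext => u.
apply: continuous_comp; first exact: initial_continuous.
move=> A [P tP sPA].
have coordP j : \forall u \near nbhs (set_val t : 'rV[R]_m.+1),
    P ord0 j (push_mx f u ord0 j).
  have : continuous (fun u : 'rV[R]_m.+1 => push_mx f u ord0 j).
    under eq_fun do rewrite mxE.
    elim: (index_enum _) => [|i r IH].
      under eq_fun do rewrite big_nil.
      by move=> u; rewrite /continuous_at big_nil; exact: (@cvg_cst R 0 _ (nbhs u)).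
    under eq_fun do rewrite big_cons.
    move=> u; rewrite /continuous_at big_cons; case: ifP => _; last exact: IH.
    by apply: cvgD; [exact: (nbhs_filter u) | exact: (@coord_continuous R _ _ ord0 i u) | exact: IH].
  by apply; exact: tP.
suff: \forall u \near nbhs (set_val t : 'rV[R]_m.+1), forall j,
    P ord0 j (push_mx f u ord0 j).
  by apply: filterS => u uP; apply: sPA => i j; rewrite ord1; exact: uP.
exact: filter_forall.
Qed.

HB.instance Definition _ m n (f : 'I_m.+1 -> 'I_n.+1) :=
  isContinuous.Build (Delta m) (Delta n) (push f) (@push_continuous m n f).

End Simplices.

Section SingularChains.
Variables (R : realType) (X : topologicalType).

Definition sing n : choiceType := continuousType (Delta R n) X.

Definition pull m n (f : 'I_m.+1 -> 'I_n.+1) (s : sing n) : sing m :=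
  s \o push f : continuousType _ _.

Definition face n (i : 'I_n.+2) (s : sing n.+1) : sing n := pull (fintype.lift i) s.

(* The restriction of s to the edge from its vertex 0 to its vertex 1. *)
Definition edge01 n (s : sing n.+1) : sing 1 :=
  pull (widen_ord (isT : (2 <= n.+2)%N)) s.

Definition loop_at (x : X) (s : sing 1) :=
  s (vertex R (ord0 : 'I_2)) = x /\ s (vertex R (ord_max : 'I_2)) = x.

(* Homotopy of paths relative to the end points. *)
Definition path_homotopic (s s' : sing 1) :=
  let e0 := vertex R (ord0 : 'I_2) in let e1 := vertex R (ord_max : 'I_2) in
  exists F : Delta R 1 * Delta R 1 -> X,
    [/\ continuous F,
        forall t, F (t, e0) = s t,
        forall t, F (t, e1) = s' t &
        forall u, F (e0, u) = s e0 /\ F (e1, u) = s e1].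

Definition chain (K : comNzRingType) n := {freeg (sing n) / K}.

(* Singular boundary with coefficients in a local system all of whose fibres
   are identified with K: the scalar (w s) is the transport along the path s.
   A coefficient lives in the fibre over vertex 0, so only face 0 needs to be
   transported.  For w = 1 this is the usual boundary. *)
Definition bd (K : comNzRingType) (w : sing 1 -> K) n :
    chain K n.+1 -> chain K n :=
  fglift (fun s : sing n.+1 => \sum_(i < n.+2)
    << (if i == ord0 then w (edge01 s) else 1) * (-1) ^+ i *g face i s >>
      : chain K n).

Definition cycles (K : comNzRingType) (w : sing 1 -> K) j : set (chain K j) :=
  match j return set (chain K j) with
  | 0 => setT
  | j'.+1 => [set c | bd w c = 0]
  end.

Definition boundaries (K : comNzRingType) (w : sing 1 -> K) j :
  set (chain K j) := range (@bd K w j).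

Definition homology_finite_dim (K : fieldType) (w : sing 1 -> K) j :=
  exists n (z : 'I_n -> chain K j), (forall l, cycles w (z l)) /\
    forall c, cycles w c ->
      exists a : 'I_n -> K, boundaries w (c - \sum_l a l *: z l).

Definition homology_neq0 (K : fieldType) (w : sing 1 -> K) j :=
  exists2 c : chain K j, cycles w c & ~ boundaries w c.

Lemma bd_additive (K : comNzRingType) (w : sing 1 -> K) n :
  additive (@bd K w n).
Proof. exact: lift_is_additive. Qed.

Definition cycles1 : {pred chain int 1} :=
  fun c => bd (fun=> 1) c == 0.

Lemma cycles1_closed : zmod_closed cycles1.
Proof.
have bdB := @bd_additive int (fun=> 1) 0; split=> [|c c'].
  by rewrite unfold_in /= -(subrr (0 : chain int 1)) bdB subrr.
by rewrite !unfold_in /= bdB => /eqP-> /eqP->; rewrite subrr.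
Qed.

HB.instance Definition _ :=
  GRing.isZmodClosed.Build (chain int 1) cycles1 cycles1_closed.

Record Z1 := MkZ1 { Z1val :> chain int 1; _ : Z1val \in cycles1 }.
HB.instance Definition _ := [isSub for Z1val].
HB.instance Definition _ := [Choice of Z1 by <:].
HB.instance Definition _ := [SubChoice_isSubZmodule of Z1 by <:].

Definition boundaries1 : {pred Z1} :=
  fun z => `[< boundaries (fun=> 1) (val z) >].

Lemma boundaries1_closed : zmod_closed boundaries1.
Proof.
have bdB := @bd_additive int (fun=> 1) 1; split=> [|c c'].
  by apply/asboolP; exists 0 => //; have := bdB 0 0; rewrite !subrr.
move=> /asboolP[b _ bc] /asboolP[b' _ bc']; apply/asboolP.
by exists (b - b') => //; rewrite bdB bc bc'.
Qed.

HB.instance Definition _ :=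
  GRing.isZmodClosed.Build Z1 boundaries1 boundaries1_closed.

Definition H1 : zmodType := Quotient.quot boundaries1.

(* The class of a 1-cycle; junk on chains that are not cycles. *)
Definition H1class (c : chain int 1) : H1 :=
  (\pi_(Quotient.quot boundaries1) (insubd (0 : Z1) c))%qT.

End SingularChains.

Section CW.
Variables (R : realType) (X : topologicalType).

Definition disk n : set 'rV[R]_n := [set x | \sum_i x ord0 i ^+ 2 <= 1].
Definition open_disk n : set 'rV[R]_n := [set x | \sum_i x ord0 i ^+ 2 < 1].
Definition sphere n : set 'rV[R]_n := [set x | \sum_i x ord0 i ^+ 2 = 1].

(* Values of a characteristic map outside the closed disk are irrelevant.  The
   restriction of chmap to the open disk is then a homeomorphism onto its
   image: X is Hausdorff, the closed disk is compact, and the open cell is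
   disjoint from the image of the sphere, which lies in cells of lower
   dimension. *)
Record cw_structure := CWStructure {
  cell : nat -> Type;
  chmap : forall n, cell n -> 'rV[R]_n -> X;
  open_cell := fun e : {n & cell n} =>
    chmap (projT2 e) @` @open_disk (projT1 e);
  cw_hausdorff : hausdorff_space X;
  cw_continuous : forall n (e : cell n), {within @disk n, continuous (chmap e)};
  cw_injective : forall n (e : cell n), set_inj (@open_disk n) (chmap e);
  cw_cover : \bigcup_e open_cell e = setT;
  cw_disjoint : trivIset setT open_cell;
  cw_closure_finite : forall n (e : cell n), exists F : set {m & cell m},
    [/\ finite_set F, forall e', F e' -> (projT1 e' < n)%N &
        chmap e @` @sphere n `<=` \bigcup_(e' in F) open_cell e'];
  cw_weak : forall S : set X, closed S <->
    forall n (e : cell n), closed (@disk n `&` chmap e @^-1` S)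
}.

Definition finite_skeleton (cw : cw_structure) k :=
  forall n, (n <= k)%N -> finite_set [set: cell cw n].

End CW.

Section AbelianGroups.
Variable H : zmodType.

Definition subgroup (xi : set H) :=
  xi 0 /\ forall x y, xi x -> xi y -> xi (x - y).

Definition pclosure (xi : set H) : set H :=
  [set x | exists2 m, (0 < m)%N & xi (x *+ m)].

Definition subgroup_sum (K L : set H) : set H :=
  [set z | exists x y, [/\ K x, L y & z = x + y]].

Definition int_independent n (x : 'I_n -> H) :=
  forall a : 'I_n -> int, \sum_l x l *~ a l = 0 -> forall l, a l = 0.

(* The largest number of independent elements, as an extended real so as to be
   meaningful for subgroups of infinite rank too. *)
Definition rank (R : realType) (S : set H) : \bar R :=
  ereal_sup [set n%:R%:E | n in [set n |
    exists x : 'I_n -> H, (forall l, S (x l)) /\ int_independent x]].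

(* L / K is cyclic of order n, for n > 0. *)
Definition cyclic_quotient (L K : set H) n :=
  exists2 g, L g & (forall m, K (g *+ m) <-> (n %| m)%N) /\
    forall x, L x -> exists m, K (x - g *+ m).

End AbelianGroups.

Section Characters.
Variables (C : fieldType) (H : zmodType).

Record character := Character {
  char_val :> H -> C;
  char_neq0 : forall x, char_val x != 0;
  charD : forall x y, char_val (x + y) = char_val x * char_val y
}.

(* The characters of L / K, for subgroups K <= L; the values of chi outside L
   are junk. *)
Definition quotient_character (L K : set H) (chi : H -> C) :=
  [/\ forall x, L x -> chi x != 0,
      forall x y, L x -> L y -> chi (x + y) = chi x * chi y &
      forall x, K x -> chi x = 1].

Definition dual_generator (L K : set H) (eta : H -> C) :=
  quotient_character L K eta /\
  forall chi, quotient_character L K chi ->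
    exists m : nat, forall x, L x -> chi x = eta x ^+ m.

(* The characters of H that restrict to eta on L. *)
Definition extensions (L : set H) (eta : H -> C) : set character :=
  [set rho | forall x, L x -> rho x = eta x].

(* T is an r-dimensional subtorus.  A homomorphism of algebraic groups from
   (C^* )^r to Hom(H, C^* ) is dual to a homomorphism phi : H -> Z^r, and it is a
   closed embedding if and only if phi is surjective. *)
Definition subtorus r (T : set character) :=
  exists2 phi : {additive H -> 'rV[int]_r}, set_surj setT setT phi &
    T = [set chi | exists2 t : 'I_r -> C, forall l, t l != 0 &
           forall h, chi h = \prod_l t l ^ phi h ord0 l].

Definition torsion_translated_subtorus r (Z : set character) :=
  exists (rho : character) (T : set character),
    [/\ exists2 m, (0 < m)%N & forall h, rho h ^+ m = 1,
        subtorus r T &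
        Z = [set chi | exists2 tau : character, T tau &
               forall h, chi h = rho h * tau h]].

Definition posdim_tt_subtorus (Z : set character) :=
  exists2 r, (0 < r)%N & torsion_translated_subtorus r Z.

Definition maximal_tt_subtorus (W Z : set character) :=
  [/\ posdim_tt_subtorus Z, Z `<=` W &
      forall Z', posdim_tt_subtorus Z' -> Z' `<=` W -> Z `<=` Z' -> Z' = Z].

Definition Xi d (W : set character) : set (set H) :=
  [set xi | [/\ subgroup xi,
    exists2 n, (n %| d)%N & cyclic_quotient (pclosure xi) xi n &
    exists2 eta, dual_generator (pclosure xi) xi eta &
      maximal_tt_subtorus W (extensions (pclosure xi) eta)]].

End Characters.

Section Epimorphisms.
Variables (H A : zmodType).

Definition epi (nu : {additive H -> A}) := set_surj setT setT nu.

Definition epi_class (nu : {additive H -> A}) : set {additive H -> A} :=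
  [set mu | exists2 alpha : {additive A -> A}, bijective alpha &
     forall x, mu x = alpha (nu x)].

Definition Gamma : set (set {additive H -> A}) :=
  [set epi_class nu | nu in epi].

Definition kernel (nu : {additive H -> A}) : set H := [set x | nu x = 0].

Definition U (R : realType) (xi : set H) : set (set {additive H -> A}) :=
  [set epi_class nu | nu in [set nu | [/\ epi nu,
    (rank R (subgroup_sum (kernel nu) xi) < rank R [set: H])%E &
    kernel nu `&` pclosure xi `<=` xi]]].

End Epimorphisms.

Section Covers.
Variables (X Y : topologicalType).

Definition covering_map (p : Y -> X) :=
  [/\ continuous p, range p = setT &
      forall x, exists (B : set X) (S : set (set Y)),
        [/\ open B /\ B x, trivIset S id, p @^-1` B = \bigcup_(V in S) V &
            forall V, S V -> [/\ open V, set_bij V B p &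
              forall W, open W -> W `<=` V -> open (p @` W)]]].

(* For connected Y, the action a of A identifies A with the group of all deck
   transformations, and p is regular. *)
Definition regular_deck_action (A : zmodType) (p : Y -> X) (a : A -> Y -> Y) :=
  [/\ forall g, continuous (a g),
      forall y, a 0 y = y,
      forall g h y, a (g + h) y = a g (a h y),
      forall g y, p (a g y) = p y &
      forall y y', p y = p y' -> exists! g, a g y = y'].

End Covers.

Section Main.
Variables (R : realType) (X : topologicalType).

(* The image of pi_1(Y, y) in pi_1(X, p y) is, for every y, the kernel of
   pi_1(X, p y) ->> H_1(X, Z) -> A. *)
Definition determined_by (A : zmodType) (nu : {additive H1 R X -> A})
    (Y : topologicalType) (p : continuousType Y X) :=
  forall (y : Y) (gamma : sing R X 1), loop_at (p y) gamma ->
    (exists2 delta : sing R Y 1, loop_at y delta &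
       path_homotopic (p \o delta : continuousType _ _) gamma) <->
    nu (H1class << gamma >>) = 0.

Definition is_cover (A : zmodType) (nu : {additive H1 R X -> A})
    (Y : topologicalType) (p : continuousType Y X) :=
  [/\ connected [set: Y], covering_map p,
      exists a : A -> Y -> Y, regular_deck_action p a &
      determined_by nu p].

(* The cover determined by nu is unique up to isomorphism over X. *)
Definition Omega (A : zmodType) i : set (set {additive H1 R X -> A}) :=
  [set epi_class nu | nu in [set nu | epi nu /\
    exists (Y : topologicalType) (p : continuousType Y X), is_cover nu p /\
      forall j, (j <= i)%N ->
        homology_finite_dim (fun=> 1 : R[i]) (X := Y) (R := R) j]].

(* The local system C_rho, given by the transport w along paths in trivialized
   fibres: w is functorial and homotopy invariant (the second condition), with
   monodromy rho.  It is unique up to isomorphism. *)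
Definition is_local_system (rho : character R[i] (H1 R X))
    (w : sing R X 1 -> R[i]) :=
  [/\ forall s, w s != 0,
      forall s : sing R X 2,
        w (face (inord 1) s) = w (face (inord 2) s) * w (face ord0 s) &
      forall x gamma, loop_at x gamma -> w gamma = rho (H1class << gamma >>)].

Definition V i : set (character R[i] (H1 R X)) :=
  [set rho | exists2 j, (1 <= j <= i)%N &
     exists2 w, is_local_system rho w & homology_neq0 w j].

End Main.

Arguments Gamma H A : clear implicits.
Arguments U {H} A R xi.
Arguments Omega R X A i : clear implicits.
Arguments V R X i : clear implicits.

(* Main.v *)
Require Import Defs.
From HB Require Import structures.
From mathcomp Require Import all_boot all_order all_algebra.
From mathcomp Require Import ring_quotient.
From mathcomp Require Import all_classical all_reals all_analysis.
From mathcomp Require Import complex freeg ring zify.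
Set Implicit Arguments.
Unset Strict Implicit.
Unset Printing Implicit Defensive.
Import Order.TTheory GRing.Theory Num.Theory.
Import numFieldNormedType.Exports.
Local Open Scope classical_set_scope.
Local Open Scope ring_scope.

(** Let Y be the cover of X determined by nu, with finite-dimensional homology
    up to degree i, and suppose that the class of nu lies in U_A(xi).  The rank
    condition provides a loop of X whose class h in H has no positive multiple
    in ker nu + xi, because loops generate H (loops_generate_H1).  The lift of
    this loop to Y defines a deck transformation b.

    On one side, b acts on the finite-dimensional spaces H_m(Y, C) for m <= i,
    so each of them is killed by some nonzero polynomial q_m in b
    (annihilating_polynomial).  Choose t nonzero that is a root of none of the
    q_m (common_nonroot).

    On the other side, ker nu meets the primitive closure of xi inside xi, so
    the generator eta extends to a character rho of H that is trivial on ker nu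
    and takes the value t at h (character_glue): a character with values in
    C^* extends to any larger group, and h is independent of the subgroup on
    which the values are imposed.  Then rho lies in the translated subtorus
    given by eta, hence in V^i(X), and some H_j(X, C_rho) with j <= i is not
    zero.

    These two sides contradict each other.  As rho is trivial on ker nu, its
    local system becomes trivial on Y (cover_trivializes), which gives a
    surjective chain map, the transfer, from the chains of Y to those of X with
    coefficients in C_rho, turning b into multiplication by rho(h) = t.  The
    chains of Y are free over the group ring of the deck group
    (equivariant_extension), so the composite of the q_m(b) for m <= j, which
    kills the homology up to degree j, is homotopic to zero up to that degree
    through an equivariant homotopy (contraction).  The homotopy descends to X,
    where the composite is multiplication by the product of the q_m(t), which
    is not zero; hence H_j(X, C_rho) = 0 (local_homology_vanishes).

    The topology needed is the lifting of singular simplices along a regular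
    covering (simplex_lift and simplex_lifts_differ, which make the chains of Y
    free), and the path-connectedness of Y, which comes from the local
    path-connectedness of CW complexes (cw_locally_path_connected). *)

(** * Abelian groups and their characters *)

Section Subgroups.
Variable H : zmodType.
Implicit Types S K L : set H.

Lemma subgroupN S x : subgroup S -> S x -> S (- x).
Proof. by move=> [S0 SB] Sx; rewrite -sub0r; exact: SB. Qed.

Lemma subgroupD S x y : subgroup S -> S x -> S y -> S (x + y).
Proof.
by move=> sS Sx Sy; rewrite -(opprK y); apply: sS.2 => //; exact: subgroupN.
Qed.

Lemma subgroupMn S x n : subgroup S -> S x -> S (x *+ n).
Proof.
move=> sS Sx; elim: n => [|n IH]; first by rewrite mulr0n; exact: sS.1.
by rewrite mulrS; exact: subgroupD.
Qed.

Lemma subgroupMz S x (n : int) : subgroup S -> S x -> S (x *~ n).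
Proof.
move=> sS Sx; case: n => n; first exact: subgroupMn.
by rewrite NegzE mulrNz; apply: subgroupN => //; exact: subgroupMn.
Qed.

Lemma subgroup_sum_subgroup K L :
  subgroup K -> subgroup L -> subgroup (subgroup_sum K L).
Proof.
move=> sK sL; split; first by exists 0, 0; rewrite addr0; split=> //;
  [exact: sK.1|exact: sL.1].
move=> _ _ [k [l [Kk Ll ->]]] [k' [l' [Kk' Ll' ->]]].
exists (k - k'), (l - l'); split; [exact: sK.2|exact: sL.2|].
by rewrite opprD addrACA.
Qed.

Lemma pclosure_subgroup S : subgroup S -> subgroup (pclosure S).
Proof.
move=> sS; split; first by exists 1%N => //; rewrite mul0rn; exact: sS.1.
move=> x y [m m0 Sx] [n n0 Sy]; exists (m * n)%N; first by rewrite muln_gt0 m0.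
rewrite mulrnBl mulrnA mulnC mulrnA; apply: sS.2; exact: subgroupMn.
Qed.

(** Multiplying each member of an independent family of H by a suitable
    positive integer gives an independent family in S. *)
Lemma pclosure_full_rank (R : realType) S :
  pclosure S = setT -> (rank R [set: H] <= rank R S)%E.
Proof.
move=> ST; apply: ge_ereal_sup => _ [n [x [_ indx]] <-].
have /choice[m mP] l : exists m, (0 < m)%N /\ S (x l *+ m).
  have : pclosure S (x l) by rewrite ST.
  by case=> m; exists m.
apply: ereal_sup_ubound; exists n => //.
exists (fun l => x l *+ m l); split=> [l|a sum0 l]; first by case: (mP l).
have /indx/(_ l)/eqP : \sum_l x l *~ (a l * m l) = 0.
  by rewrite -[RHS]sum0; apply: eq_bigr => k _; rewrite mulrC mulrzA -pmulrn.
by rewrite mulf_eq0 eqz_nat eqn0Ngt (mP l).1 orbF => /eqP.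
Qed.

End Subgroups.

Section CharacterExtension.
Variables (C : closedFieldType) (H : zmodType).

(** A homomorphism to the units of C from a subgroup of H, encoded by its graph
    so that the union of a chain is formed without gluing functions. *)
Definition partial_character (G : set (H * C)) :=
  [/\ G (0, 1), (forall x z y w, G (x, z) -> G (y, w) -> G (x - y, z / w)) &
      forall z, G (0, z) -> z = 1].

Lemma partial_character_functional G x z w :
  partial_character G -> G (x, z) -> G (x, w) -> z = w.
Proof.
move=> [G01 GB G1] Gz Gw.
have w0 : w != 0.
  apply/eqP => w0; have := GB _ _ _ _ Gw Gw; rewrite subrr w0 mul0r => /G1.
  by move/esym/eqP; rewrite oner_eq0.
by have := GB _ _ _ _ Gz Gw; rewrite subrr => /G1/divr1_eq.
Qed.

Lemma partial_character_neq0 G x z : partial_character G -> G (x, z) -> z != 0.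
Proof.
move=> [G01 GB G1] Gz; apply/eqP => z0.
have := GB _ _ _ _ Gz Gz; rewrite subrr z0 mul0r => /G1.
by move/esym/eqP; rewrite oner_eq0.
Qed.

Lemma partial_characterN G x z :
  partial_character G -> G (x, z) -> G (- x, z^-1).
Proof. by move=> [G0 GB _] Gx; rewrite -sub0r -div1r; exact: GB. Qed.

Lemma partial_characterD G x z y w : partial_character G ->
  G (x, z) -> G (y, w) -> G (x + y, z * w).
Proof.
move=> pG Gx Gy; have := pG; case=> _ GB _.
by rewrite -(opprK y) -[w]invrK; apply: GB => //; exact: partial_characterN.
Qed.

Lemma partial_characterMn G x z n :
  partial_character G -> G (x, z) -> G (x *+ n, z ^+ n).
Proof.
move=> pG Gx; elim: n => [|n IH]; first by rewrite mulr0n expr0; case: pG.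
by rewrite mulrS exprS; exact: partial_characterD.
Qed.

Lemma partial_characterMz G x z (n : int) :
  partial_character G -> G (x, z) -> G (x *~ n, z ^ n).
Proof.
move=> pG Gx; case: n => n; first exact: partial_characterMn.
rewrite NegzE mulrNz -exprnN; apply: partial_characterN => //.
exact: partial_characterMn.
Qed.

(** If d is the least positive integer such that the value at d y is defined,
    the value at y may be any d-th root of it, and a root exists because C is
    algebraically closed; if there is no such d, it may be any
    nonzero scalar. *)
Lemma partial_character_extend1 G y : partial_character G ->
  exists2 G', partial_character G' & G `<=` G' /\ exists z, G' (y, z).
Proof.
move=> pG; have [G0 GB G1] := pG.
have [z zn0 zP] : exists2 z, z != 0 &
    forall (n : int) c, G (y *~ n, c) -> c = z ^ n.
  pose P d := (0 < d)%N && `[< exists c, G (y *+ d, c) >].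
  have [exd|nod] := pselect (exists d, P d); last first.
    exists 1; first exact: oner_neq0.
    move=> n c Gc; case: n Gc => [[|n]|n] Gc.
    - by rewrite exp1rz; apply: G1; rewrite mulr0z in Gc.
    - by case: nod; exists n.+1; rewrite /P /=; apply/asboolP; exists c.
    - case: nod; exists n.+1; rewrite /P /=; apply/asboolP; exists c^-1.
      have := partial_characterN pG Gc.
      by rewrite NegzE mulrNz opprK.
  case: (ex_minnP exd) => d /andP[d0 /asboolP[v Gv]] dmin.
  have [z zd] : exists z : C, z ^+ d = v.
    have [z] := @solve_monicpoly C d (fun i => if i == 0%N then v else 0) d0.
    case: d d0 Gv dmin => // d _ Gv dmin; rewrite big_ord_recl /= expr0 mulr1.
    by rewrite big1 ?addr0 => [|i _]; [exists z|rewrite mul0r].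
  have v0 := partial_character_neq0 pG Gv.
  have z0 : z != 0 by apply: contraNneq v0 => z0; rewrite -zd z0 expr0n -leqn0 leqNgt d0.
  exists z => // n c Gc.
  have [q [r [rd nE]]] : exists (q : int) (r : nat), (r < d)%N /\ n = q * d + r.
    exists (n %/ d)%Z, `|(n %% d)%Z|%N.
    have dn0 : (d : int) != 0 by rewrite -lt0n.
    rewrite {2}(divz_eq n d); split; last by rewrite gez0_abs ?modz_ge0.
    by rewrite -ltz_nat gez0_abs ?modz_ge0 // ltz_pmod.
  have Gr : G (y *+ r, c / v ^ q).
    have -> : y *+ r = y *~ n - y *+ d *~ q.
      by rewrite nE mulrzDr [q * _]mulrC mulrzA -!pmulrn addrAC subrr add0r.
    exact: GB Gc (partial_characterMz q pG Gv).
  have r0 : r = 0%N.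
    apply: contraTeq rd; rewrite -lt0n -leqNgt => r0; apply: dmin.
    by rewrite /P r0; apply/asboolP; exists (c / v ^ q).
  move: Gr; rewrite r0 mulr0n => /G1/divr1_eq ->.
  by rewrite nE r0 addr0 mulrC -exprz_exp -exprnP zd.
exists [set u | exists (n : int) x c, [/\ G (x, c), u.1 = x + y *~ n & u.2 = c * z ^ n]].
- split=> /=.
  + by exists 0, 0, 1; rewrite mulr0z addr0 expr0z mulr1.
  + move=> ? ? ? ? [n [x [c [Gx -> ->]]]] [n' [x' [c' [Gx' -> ->]]]].
    exists (n - n'), (x - x'), (c / c'); split; first exact: GB.
      by rewrite mulrzBr opprD addrACA.
    by rewrite expfzDr // -invr_expz invfM mulrACA.
  + move=> _ [n [x [c [Gx /esym/eqP]]]] + ->.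
    rewrite addr_eq0 => /eqP xE.
    have := partial_characterN pG Gx; rewrite xE opprK => /zP <-.
    by rewrite divff // (partial_character_neq0 pG Gx).
- split; first by move=> [x c] Gx; exists 0, x, c; rewrite mulr0z addr0 expr0z mulr1.
  by exists z, 1, 0, 1; rewrite add0r mul1r mulr1z expr1z.
Qed.

Lemma partial_character_extension G : partial_character G ->
  exists rho : character C H, forall x z, G (x, z) -> rho x = z.
Proof.
move=> pG.
(* Zorn's lemma for unions also considers the empty chain, whose union is not
   a partial character: hence the union with G. *)
pose P := [set G' | partial_character (G' `|` G)].
have [F FP totF|M [pM maxM]] := @Zorn_bigcup _ P.
  split=> /=.
  - by right; case: pG.
    move=> x z y w [[A FA Ax]|Gx] [[B FB By]|Gy].
    + have [AB|BA] := totF _ _ FA FB.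
      * have [_ /(_ x z y w)] := FP _ FB.
        by case=> [||?|?]; [left; exact: AB|left| left; exists B|right].
      * have [_ /(_ x z y w)] := FP _ FA.
        by case=> [||?|?]; [left|left; exact: BA| left; exists A|right].
    + have [_ /(_ x z y w)] := FP _ FA.
      by case=> [||?|?]; [left|right| left; exists A|right].
    + have [_ /(_ x z y w)] := FP _ FB.
      by case=> [||?|?]; [right|left| left; exists B|right].
    + by right; case: pG => _ + _; apply.
  - move=> z [[A FA Az]|Gz]; last by case: pG => _ _; apply.
    by have [_ _] := FP _ FA; apply; left.
have tot y : exists z, (M `|` G) (y, z).
  have [G' pG' [sub [z G'z]]] := partial_character_extend1 y pM.
  exists z; left; apply: contrapT => nM; apply: (maxM G').
    split; first by move=> u Mu; apply: sub; left.
    by move/(_ (y, z) G'z).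
  by rewrite /P /= (_ : G' `|` G = G') //; apply/setUidPl => u Gu; apply: sub; right.
have /choice[f fP] := tot.
have f0 x : f x != 0 by exact: (partial_character_neq0 pM).
have fD x y : f (x + y) = f x * f y.
  by apply: (partial_character_functional pM (fP _)); exact: partial_characterD.
exists (Character f0 fD) => x z Gx /=.
by apply: (partial_character_functional pM (fP _)); right.
Qed.

(** The prescribed values are consistent: eta is trivial where K meets L, and
    no multiple of h is in K + L.  Partial characters extend to H. *)
Lemma character_glue (K L : set H) (eta : H -> C) (h : H) (t : C) :
  subgroup K -> subgroup L ->
  quotient_character L (K `&` L) eta ->
  (forall m, (0 < m)%N -> ~ subgroup_sum K L (h *+ m)) -> t != 0 ->
  exists rho : character C H, [/\ forall x, K x -> rho x = 1,
    forall x, L x -> rho x = eta x & rho h = t].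
Proof.
move=> sK sL [eta0 etaD eta1] hn t0.
have etaV x : L x -> eta (- x) = (eta x)^-1.
  move=> Lx; apply: (mulIf (eta0 _ Lx)); rewrite mulVf ?eta0 //.
  rewrite -etaD ?addNr //; first by apply: eta1; split; [exact: sK.1|exact: sL.1].
  exact: subgroupN.
pose G := [set u : H * C | exists k l (n : int),
  [/\ K k, L l, u.1 = k + l + h *~ n & u.2 = eta l * t ^ n]].
have K0 := sK.1; have L0 := sL.1; have eta01 : eta 0 = 1 by exact: eta1.
have hnz (n : int) : subgroup_sum K L (h *~ n) -> n = 0.
  case: n => [[|n]|n] //; first by move/hn; case.
  rewrite NegzE mulrNz => /(subgroupN (subgroup_sum_subgroup sK sL)).
  by rewrite opprK => /hn; case.
have pG : partial_character G.
  split.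
  - by exists 0, 0, 0; rewrite /= ?mulr0z !addr0 expr0z mulr1.
  - move=> x z y w [k [l [n [Kk Ll /= -> ->]]]] [k' [l' [n' [Kk' Ll' /= -> ->]]]].
    exists (k - k'), (l - l'), (n - n'); split=> /=; [exact: sK.2|exact: sL.2| |].
      by rewrite mulrzBr !opprD addrACA (addrACA k).
    rewrite etaD ?etaV //; last exact: subgroupN.
    by rewrite expfzDr // -invr_expz invfM mulrACA.
  - move=> z [k [l [n [Kk Ll /= E ->]]]].
    have n0 : n = 0.
      apply: hnz; exists (- k), (- l); split; [exact: subgroupN|exact: subgroupN|].
      by apply/eqP; rewrite -opprD -subr_eq0 opprK addrC -E.
    move: E; rewrite n0 mulr0z addr0 expr0z mulr1 => /esym/eqP.
    rewrite addr_eq0 => /eqP kE; apply: eta1; split=> //.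
    by rewrite -(opprK l) -kE; exact: subgroupN.
have [rho rhoP] := partial_character_extension pG.
exists rho; split=> [x Kx|x Lx|]; apply: rhoP.
- by exists x, 0, 0; rewrite /= ?mulr0z !addr0 expr0z mulr1 eta01.
- by exists 0, x, 0; rewrite /= add0r mulr0z expr0z mulr1 addr0.
- by exists 0, 0, 1; rewrite /= !add0r mulr1z expr1z eta01 mul1r.
Qed.

End CharacterExtension.

(** * Euclidean topology and simplices *)

Section General.
Variable R : realType.

Lemma continuous_rV (T : topologicalType) n (f : T -> 'rV[R]_n) :
  (forall j, continuous (fun t => f t ord0 j)) -> continuous f.
Proof.
move=> cf t A [P tP sPA].
suff: \forall u \near t, forall j, P ord0 j (f u ord0 j).
  by apply: filterS => u uP; apply: sPA => i j; rewrite ord1; exact: uP.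
by apply: filter_forall => j; apply: (cf j t); exact: tP.
Qed.

Lemma continuous_sumr (T : topologicalType) (I : Type) (r : seq I)
    (P : pred I) (F : I -> T -> R) :
  (forall i, P i -> continuous (F i)) ->
  continuous (fun t => \sum_(i <- r | P i) F i t).
Proof.
by move=> cF; apply: continuous_big => //; exact: add_continuous.
Qed.

Section RealFunctions.
Variables (T : topologicalType) (f g : T -> R).
Hypotheses (cf : continuous f) (cg : continuous g).

Lemma continuous_addr : continuous (fun x => f x + g x).
Proof. by move=> x; apply: cvgD; [exact: cf|exact: cg]. Qed.

Lemma continuous_subr : continuous (fun x => f x - g x).
Proof. by move=> x; apply: cvgB; [exact: cf|exact: cg]. Qed.

Lemma continuous_mulr : continuous (fun x => f x * g x).
Proof. by move=> x; apply: cvgM; [exact: cf|exact: cg]. Qed.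

Lemma continuous_maxr : continuous (fun x => Num.max (f x) (g x)).
Proof. by move=> x; apply: (@continuous_max R _ f g); [exact: cf|exact: cg]. Qed.

Lemma continuous_invr : (forall x, f x != 0) -> continuous (fun x => (f x)^-1).
Proof. by move=> f0 x; apply: cvgV; [exact: f0|exact: cf]. Qed.

End RealFunctions.

Lemma continuous_delta (T : topologicalType) n (f : T -> Delta R n) :
  (forall j, continuous (fun t => set_val (f t) ord0 j)) -> continuous f.
Proof. by move=> cf; apply: continuous_comp_initial; exact: continuous_rV. Qed.

Lemma continuous_delta_coord n j :
  continuous (fun t : Delta R n => set_val t ord0 j).
Proof.
move=> t; apply: (@continuous_comp _ _ _ (@set_val _ _)
  (fun x : 'rV[R]_n.+1 => x ord0 j)).
  exact: initial_continuous.
exact: coord_continuous.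
Qed.

Lemma continuous_comp_within (T U V : topologicalType) (D : set U) (f : T -> U)
    (g : U -> V) : {within D, continuous g} -> continuous f ->
  (forall t, D (f t)) -> continuous (g \o f).
Proof.
move=> /subspace_continuousP cg cf Df t O gO.
have : \forall u \near t, D (f u) -> O (g (f u)) by exact: cf (cg _ (Df t) _ gO).
by apply: filterS => u; apply; exact: Df.
Qed.

Lemma continuous_if (T U : topologicalType) (f g : T -> U) (h : T -> R) :
  continuous f -> continuous g -> continuous h ->
  (forall t, h t = 0 -> f t = g t) ->
  continuous (fun t => if 0 <= h t then f t else g t).
Proof.
move=> cf cg ch fg.
have UT : h @^-1` [set x | 0 <= x] `|` h @^-1` [set x | x <= 0] = setT.
  by apply/seteqP; split=> // t _; apply/orP; exact: le_total.
apply/continuous_subspace_setT; rewrite -UT; apply: withinU_continuous.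
- by apply: preimage_closed; [move=> t _; exact: ch|exact: closed_ge].
- by apply: preimage_closed; [move=> t _; exact: ch|exact: closed_le].
- apply: (@subspace_eq_continuous _ _ _ f); last exact: continuous_subspaceT.
  by move=> t; rewrite inE /preimage /= /from_subspace => ->.
- apply: (@subspace_eq_continuous _ _ _ g); last exact: continuous_subspaceT.
  move=> t; rewrite inE /preimage /= /from_subspace => ht; case: ifP => // th.
  by rewrite fg //; apply: le_anti; rewrite ht th.
Qed.

Lemma connected_locally_constant (T : topologicalType) (B : Type)
    (A : set T) (b : T -> B) : connected A ->
  (forall x, A x -> \forall y \near x, A y -> b y = b x) ->
  forall x y, A x -> A y -> b x = b y.
Proof.
move=> cA lb x y Ax Ay.
have op (Q : set B) : exists2 C, open C & A `&` [set z | Q (b z)] = A `&` C.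
  exists (\bigcup_(z in [set z | A z /\ Q (b z)]) [set w | A w -> b w = b z]°).
    by apply: bigcup_open => z _; exact: open_interior.
  apply/seteqP; split=> z [Az].
    move=> Qz; split=> //; exists z => //; exact: lb.
  by move=> [w [Aw Qw] /interior_subset /(_ Az) bz]; split; rewrite //= bz.
have := cA (A `&` [set z | b z = b x]); move=> /(_ _ _ _)/esym H.
have : A y by []. rewrite H; first by case.
- by exists x.
- exact: (op (fun c => c = b x)).
- have [C oC CE] := op (fun c => c <> b x).
  exists (~` C); first exact: open_closedC.
  apply/seteqP; split=> z [Az zx]; split=> //.
    by move=> Cz; have : (A `&` C) z by []; rewrite -CE => -[].
  apply: contrapT => bz; apply: zx.
  by have : (A `&` [set z | b z <> b x]) z by []; rewrite CE => -[].
Qed.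

(** If s is the supremum of the c in [a, b] such that P a c holds, the local
    hypothesis at s carries P beyond s, unless s = b. *)
Lemma cousin (P : R -> R -> Prop) :
  (forall a b c, a <= b -> b <= c -> P a b -> P b c -> P a c) ->
  (forall r, exists2 d, 0 < d &
     forall a b, r - d <= a -> a <= b -> b <= r + d -> P a b) ->
  forall a b, a <= b -> P a b.
Proof.
move=> PU Ploc a b ab.
have Pxx x : P x x.
  have [d d0] := Ploc x; apply=> //; [by rewrite gerBl ltW|by rewrite lerDl ltW].
pose A := [set c | a <= c <= b /\ P a c].
have Aa : A a by split; rewrite ?lexx.
have hA : has_sup A by split; [exists a | exists b => c [/andP[_ ->]]].
have [d d0 dP] := Ploc (sup A).
have [c [/andP[ac cb] Pac] cs] := sup_adherent d0 hA.
have cle x : A x -> x <= sup A by exact: sup_upper_bound.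
have csup : c <= sup A by apply: cle; rewrite /A /= ac cb.
have sd : sup A <= sup A + d by rewrite lerDl ltW.
have Ae : A (Num.min b (sup A + d)).
  have ce : c <= Num.min b (sup A + d).
    by rewrite le_min cb (le_trans csup).
  split; first by rewrite (le_trans ac ce) ge_min lexx.
  apply: (PU _ c) => //; apply: dP => //; first exact: ltW.
  by rewrite ge_min lexx orbT.
have := cle _ Ae; rewrite ge_min => /orP[bs|]; last first.
  by rewrite gerDl leNgt d0.
by case: Ae => _; rewrite (min_idPl _) // (le_trans bs).
Qed.

Definition box n (lo hi : 'I_n -> R) : set 'rV[R]_n :=
  [set y | forall l, lo l <= y ord0 l <= hi l].

Lemma box_closed n (lo hi : 'I_n -> R) : closed (box lo hi).
Proof.
rewrite (_ : box lo hi = \bigcap_(l in setT)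
    ((fun y : 'rV[R]_n => y ord0 l) @^-1` ([set x | lo l <= x] `&` [set x | x <= hi l]))).
  apply: closed_bigI => l _; apply: preimage_closed.
    by move=> y _; exact: coord_continuous.
  by apply: closedI; [exact: closed_ge|exact: closed_le].
by apply/seteqP; split=> y yP l; [case/andP: (yP l)|rewrite (yP l I).1 (yP l I).2].
Qed.

Definition segment n (x y : 'rV[R]_n) (r : R) : 'rV[R]_n := x + r *: (y - x).

Lemma continuous_segment n (x y : 'rV[R]_n) : continuous (segment x y).
Proof.
apply: continuous_rV => j; under eq_fun do rewrite !mxE.
apply: continuous_addr; first exact: cst_continuous.
by apply: continuous_mulr; [move=> r; exact: cvg_id|exact: cst_continuous].
Qed.

Lemma segment_between n (x y : 'rV[R]_n) r j a b : 0 <= r <= 1 ->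
  a <= x ord0 j <= b -> a <= y ord0 j <= b -> a <= segment x y r ord0 j <= b.
Proof.
move=> /andP[r0 r1] /andP[ax xb] /andP[ay yb]; rewrite !mxE.
have -> : x ord0 j + r * (y ord0 j - x ord0 j) =
  (1 - r) * x ord0 j + r * y ord0 j by rewrite mulrBl mul1r mulrBr addrAC addrA.
have r1' : 0 <= 1 - r by rewrite subr_ge0.
have E c : c = (1 - r) * c + r * c by rewrite -mulrDl subrK mul1r.
by apply/andP; split; [rewrite (E a)|rewrite (E b)]; apply: lerD; exact: ler_wpM2l.
Qed.

Lemma star_connected n (A : set 'rV[R]_n) x : A x ->
  (forall y r, A y -> 0 <= r <= 1 -> A (segment x y r)) -> connected A.
Proof.
move=> Ax sA.
rewrite (_ : A = \bigcup_(y in A) (segment x y @` `[0, 1])).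
  apply: bigcup_connected.
    exists x => y _; exists 0; first by rewrite /= in_itv /= lexx ler01.
    by rewrite /segment scale0r addr0.
  move=> y _; apply: connected_continuous_connected; first exact: segment_connected.
  by apply: continuous_subspaceT; exact: continuous_segment.
apply/seteqP; split=> [y Ay|_ [y Ay [r r01 <-]]]; last first.
  by apply: sA => //; move: r01; rewrite /= in_itv.
exists y => //; exists 1; first by rewrite /= in_itv /= lexx ler01.
by rewrite /segment scale1r addrC subrK.
Qed.

Lemma box_connected n (lo hi : 'I_n -> R) : connected (box lo hi).
Proof.
have [[x bx]|/forallNP b0] := pselect (exists x, box lo hi x).
  by apply: (star_connected bx) => y r By r01 l; exact: segment_between.
by rewrite (_ : box lo hi = set0); [exact: connected0|apply/seteqP; split=> x // /b0].
Qed.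

(** Dividing these weights by their sum gives a retraction of the ambient space
    onto the simplex, through which maps on a simplex become maps on a cube.
    The second term makes the sum at least 1. *)
Definition simplex_weight n (x : 'rV[R]_n.+1) (j : 'I_n.+1) : R :=
  Num.max (x ord0 j) 0 +
  (j == ord0)%:R * Num.max (1 - \sum_l Num.max (x ord0 l) 0) 0.

Lemma simplex_weight_ge0 n (x : 'rV[R]_n.+1) j : 0 <= simplex_weight x j.
Proof. by rewrite addr_ge0 ?mulr_ge0 ?ler0n // le_max lexx orbT. Qed.

Lemma sum_simplex_weight n (x : 'rV[R]_n.+1) :
  \sum_j simplex_weight x j =
  \sum_j Num.max (x ord0 j) 0 + Num.max (1 - \sum_l Num.max (x ord0 l) 0) 0.
Proof.
rewrite big_split /=; congr (_ + _); move: (Num.max (1 - _) 0) => M.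
by rewrite (bigD1 ord0) //= mul1r big1 ?addr0 // => j /negbTE ->; rewrite mul0r.
Qed.

Lemma sum_simplex_weight_gt0 n (x : 'rV[R]_n.+1) : 0 < \sum_j simplex_weight x j.
Proof.
rewrite sum_simplex_weight; set S := \sum_j _.
apply: (@lt_le_trans _ _ (S + (1 - S))); first by rewrite addrC subrK ltr01.
by rewrite lerD2l le_max lexx.
Qed.

Lemma simplex_retract_subproof n (x : 'rV[R]_n.+1) :
  (\row_j (simplex_weight x j / \sum_l simplex_weight x l)) \in @simplex R n.
Proof.
have S0 := sum_simplex_weight_gt0 x.
apply/mem_set; split=> [j|].
  by rewrite mxE divr_ge0 ?simplex_weight_ge0 // ltW.
under eq_bigr do rewrite mxE.
by rewrite -mulr_suml divff // gt_eqF.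
Qed.

Definition simplex_retract n (x : 'rV[R]_n.+1) : Delta R n :=
  exist (fun t => t \in @simplex R n) _ (simplex_retract_subproof x).

Lemma simplex_retract_continuous n : continuous (@simplex_retract n).
Proof.
have cpos j : continuous (fun x : 'rV[R]_n.+1 => Num.max (x ord0 j) 0).
  apply: continuous_maxr; [exact: coord_continuous|exact: cst_continuous].
have cS : continuous (fun x : 'rV[R]_n.+1 => \sum_l Num.max (x ord0 l) 0).
  by apply: continuous_sumr => l _; exact: cpos.
have cw j : continuous (fun x : 'rV[R]_n.+1 => simplex_weight x j).
  apply: continuous_addr; first exact: cpos.
  apply: continuous_mulr; first exact: cst_continuous.
  apply: continuous_maxr; last exact: cst_continuous.
  by apply: continuous_subr; [exact: cst_continuous|exact: cS].
apply: continuous_delta => j; under eq_fun do rewrite /= mxE.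
apply: continuous_mulr; first exact: cw.
apply: continuous_invr; first by apply: continuous_sumr => l _; exact: cw.
by move=> x; exact/lt0r_neq0/sum_simplex_weight_gt0.
Qed.

Lemma deltaP n (t : Delta R n) : simplex (set_val t).
Proof. exact: set_valP. Qed.

Lemma delta_ext n (s t : Delta R n) :
  (forall j, set_val s ord0 j = set_val t ord0 j) -> s = t.
Proof. by move=> st; apply: val_inj; apply/rowP. Qed.

Lemma simplex_retractK n (t : Delta R n) : simplex_retract (set_val t) = t.
Proof.
have [t0 t1] := deltaP t.
have tE j : Num.max (set_val t ord0 j) 0 = set_val t ord0 j by apply/max_idPl.
have wE j : simplex_weight (set_val t) j = set_val t ord0 j.
  rewrite /simplex_weight; under eq_bigr do rewrite tE.
  by rewrite t1 subrr tE maxxx mulr0 addr0.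
apply: delta_ext => j; rewrite /= mxE; under eq_bigr do rewrite wE.
by rewrite t1 divr1 wE.
Qed.

Lemma delta_connected n : connected [set: Delta R n].
Proof.
rewrite (_ : setT = @simplex_retract n @` setT).
  apply: connected_continuous_connected.
    by apply: (@star_connected _ _ 0).
  by apply: continuous_subspaceT; exact: simplex_retract_continuous.
by apply/seteqP; split=> // t _; exists (set_val t) => //; exact: simplex_retractK.
Qed.

Lemma delta_box n (t : Delta R n) : box (fun=> 0) (fun=> 1) (set_val t).
Proof.
have [t0 t1] := deltaP t; move=> l; rewrite t0 /= -t1 (bigD1 l) //= lerDl.
by rewrite sumr_ge0.
Qed.

End General.

(** * Lifting along a regular covering *)

Section Covering.
Variables (R : realType) (X Y : topologicalType) (A : zmodType).
Variables (p : Y -> X) (a : A -> Y -> Y).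
Hypotheses (cov : covering_map p) (deck : regular_deck_action p a).

Lemma covering_sheet y : exists V : set Y, [/\ open V, V y, set_inj V p &
  forall W, open W -> W `<=` V -> open (p @` W)].
Proof.
have [_ _ /(_ (p y))[B [S [[oB By] _ pB SP]]]] := cov.
have : (p @^-1` B) y by [].
rewrite pB => -[V SV Vy]; exists V; have [oV [_ injV _] openV] := SP _ SV.
by split.
Qed.

Lemma deck_continuous b : continuous (a b). Proof. by case: deck. Qed.
Lemma deck0 y : a 0 y = y. Proof. by case: deck. Qed.
Lemma deckD b c y : a (b + c) y = a b (a c y). Proof. by case: deck. Qed.
Lemma deckp b y : p (a b y) = p y. Proof. by case: deck. Qed.

Lemma deck_inj b c y : a b y = a c y -> b = c.
Proof.
move=> bc; have [_ _ _ _ /(_ y (a b y))[|g [_ gu]]] := deck; first by rewrite deckp.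
by rewrite -(gu b) // -(gu c).
Qed.

Lemma deck_trans y y' : p y = p y' -> exists b, a b y = y'.
Proof. by case: deck => _ _ _ _ /[apply] -[b [bP _]]; exists b. Qed.

(** The deck transformation comparing two lifts is locally constant, because near
    each point both the second lift and the translated first one run in the same
    sheet. *)
Lemma lifts_differ_by_deck (T : topologicalType) (K : set T) (g h : T -> Y) :
  connected K -> {within K, continuous g} -> {within K, continuous h} ->
  (forall x, K x -> p (g x) = p (h x)) ->
  exists b, forall x, K x -> a b (g x) = h x.
Proof.
move=> cK /subspace_continuousP cg /subspace_continuousP ch gh.
have /choice[b bP] x : exists b, K x -> a b (g x) = h x.
  have [Kx|nKx] := pselect (K x); last by exists 0.
  by have [b] := deck_trans (gh _ Kx); exists b.
have [[x0 Kx0]|/forallNP K0] := pselect (exists x, K x); last first.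
  by exists 0 => x /K0.
exists (b x0) => x Kx.
rewrite (_ : b x0 = b x); first exact: bP.
apply: (connected_locally_constant cK) => // y Ky.
have [V [oV Vy injV _]] := covering_sheet (h y).
have Vhy : \forall z \near within K (nbhs y), V (h z).
  by apply: (ch y Ky); exact: open_nbhs_nbhs.
have Vgy : \forall z \near within K (nbhs y), V (a (b y) (g z)).
  apply: (cg y Ky (a (b y) @^-1` V)); apply: deck_continuous.
  by rewrite bP //; exact: open_nbhs_nbhs.
have H : \forall z \near y, K z -> V (h z) /\ V (a (b y) (g z)).
  exact: (filterI Vhy Vgy).
apply: (filterS _ H) => z zP Kz.
have [Vhz Vgz] := zP Kz.
apply: (@deck_inj _ _ (g z)); rewrite bP //.
by apply: injV; rewrite ?inE // deckp gh.
Qed.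

Definition liftable (T : topologicalType) (f : T -> X) (K : set T) :=
  exists g : T -> Y, {within K, continuous g} /\ forall x, K x -> p (g x) = f x.

Lemma liftable_sub (T : topologicalType) (f : T -> X) (K L : set T) :
  K `<=` L -> liftable f L -> liftable f K.
Proof.
move=> KL [g [cg gf]]; exists g; split; last by move=> x /KL; exact: gf.
exact: continuous_subspaceW cg.
Qed.

(** The inverse of p on a sheet is continuous there because p maps open subsets
    of the sheet to open sets. *)
Lemma sheet_section y : exists (V : set Y) (q : X -> Y),
  [/\ open V, V y, open (p @` V), {in V, cancel p q} &
      (forall x, (p @` V) x -> p (q x) = x) /\ {within p @` V, continuous q}].
Proof.
have [V [oV Vy injV openV]] := covering_sheet y.
have /choice[q qP] x : exists q, (p @` V) x -> V q /\ p q = x.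
  have [[w Vw wx]|n] := pselect ((p @` V) x); first by exists w.
  by exists y.
exists V, q; split=> //; first exact: openV.
  move=> z; rewrite inE => Vz.
  have [|Vq pq] := qP (p z); first by exists z.
  by apply: injV; rewrite ?inE.
split=> [x /qP[]//|]; apply/subspace_continuousP => x Vx O /=.
rewrite nbhsE => -[W [oW Wx] WO].
have [Vqx pqx] := qP _ Vx.
have : \forall t \near x, (p @` (W `&` V)) t.
  apply: open_nbhs_nbhs; split; last by exists (q x).
  by apply: openV; [exact: openI|move=> ? []].
apply: filterS => t [w [Ww Vw] wt] Vt; apply: WO.
have [Vqt pqt] := qP _ Vt.
have qw : w = q t by apply: injV; rewrite ?inE // pqt wt.
by move: Ww; rewrite qw.
Qed.

Lemma liftable_near (T : topologicalType) (f : T -> X) (x : T) : continuous f ->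
  exists2 U : set T, nbhs x U & liftable f U.
Proof.
move=> cf; have [_ prange _] := cov.
have [y _ pyx] : range p (f x) by rewrite prange.
have [V [q [_ Vy oV _ [qK cq]]]] := sheet_section y.
exists (f @^-1` (p @` V)).
  by apply: cf; apply: open_nbhs_nbhs; split=> //; exists y.
exists (q \o f); split; last by move=> z Vz; exact: qK.
apply/subspace_continuousP => z Vz O qO.
have /= H := (subspace_continuousP _ _).1 cq _ Vz _ qO.
exact: (cf z _ H).
Qed.

(** The two lifts differ by a deck transformation over the connected overlap;
    translating one of them by it makes them agree there. *)
Lemma liftable_glue (T : topologicalType) (f : T -> X) (K L : set T) :
  closed K -> closed L -> connected (K `&` L) -> 
  liftable f K -> liftable f L -> liftable f (K `|` L).
Proof.
move=> clK clL cKL [g [cg gf]] [h [ch hf]].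
have [||x [Kx Lx]|b bP] := lifts_differ_by_deck (g := g) (h := h) cKL.
- by apply: continuous_subspaceW cg => x [].
- by apply: continuous_subspaceW ch => x [].
- by rewrite gf ?hf.
exists (fun x => if `[< K x >] then a b (g x) else h x).
split; last first.
  move=> x Ux; case: (pselect (K x)) => Kx.
    by rewrite asboolT // deckp gf.
  rewrite asboolF //; by case: Ux => // /hf.
apply: withinU_continuous => //.
- apply: (@subspace_eq_continuous _ _ _ (a b \o g)).
    by move=> x; rewrite inE => Kx; rewrite /from_subspace asboolT.
  by apply: within_continuous_comp cg => y _; exact: deck_continuous.
- apply: (@subspace_eq_continuous _ _ _ h) => //.
  by move=> x; rewrite inE => Lx; rewrite /from_subspace; case: (pselect (K x)) => Kx;
    [rewrite asboolT // bP|rewrite asboolF].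
Qed.

(** By induction on k, lifts exist over slabs that have the full size of the box
    in the first k directions and are thin in the other ones: the compactness
    of one more side of the box, in the form of Cousin's lemma, lets the lifts
    over thin slabs be glued. *)
Lemma liftable_box n (f : 'rV[R]_n -> X) (lo hi : 'I_n -> R) : continuous f ->
  (forall l, lo l <= hi l) -> liftable f (box lo hi).
Proof.
move=> cf lohi.
pose slab k (x : 'I_n -> R) (d : R) := box
  (fun l : 'I_n => if (l < k)%N then lo l else x l - d)
  (fun l : 'I_n => if (l < k)%N then hi l else x l + d).
suff claim k : (k <= n)%N ->
    forall x, exists2 d, 0 < d & liftable f (slab k x d).
  have [d d0] := claim n (leqnn n) (fun=> 0); apply: liftable_sub => y yP l.
  by rewrite ltn_ord.
elim: k => [_ x|k IH kn x].
  have [U + liftU] := liftable_near (\row_l x l) cf.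
  move=> /nbhs_ballP[d /= d0 dU]; exists (d / 2); first by rewrite divr_gt0.
  apply: liftable_sub liftU => y yP; apply: dU.
  split=> // i j; rewrite ord1 mxE; have := yP j; rewrite ltn0.
  move=> /andP[y1 y2]; change (`|x j - y ord0 j| < d).
  apply: (@le_lt_trans _ _ (d / 2)); last by rewrite ltr_pdivrMr // ltr_pMr // ltr1n.
  by rewrite distrC ler_distl y1 y2.
pose k' := Ordinal kn.
pose mid u v d := box
  (fun l : 'I_n => if (l < k)%N then lo l else if l == k' then u else x l - d)
  (fun l : 'I_n => if (l < k)%N then hi l else if l == k' then v else x l + d).
pose P u v := exists2 d, 0 < d & liftable f (mid u v d).
have mid_sub u v d e : e <= d -> mid u v e `<=` mid u v d.
  move=> ed y yP l; have := yP l; case: ifP => // _; case: ifP => // _.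
  move=> /andP[y1 y2]; rewrite (le_trans _ y1) ?(le_trans y2) //.
    by rewrite lerD2l.
  by rewrite lerD2l lerN2.
have [||d d0 lift] := @cousin R P _ _ _ _ (lohi k').
- move=> u v w uv vw [d d0 liftd] [e e0 lifte].
  pose m := Num.min d e; have m0 : 0 < m by rewrite lt_min d0.
  exists m => //.
  have : liftable f (mid u v m `|` mid v w m).
    apply: liftable_glue; [exact: box_closed|exact: box_closed| | |].
    + rewrite (_ : _ `&` _ = mid v v m); first exact: box_connected.
      apply/seteqP; split=> y.
        move=> [y1 y2] l; move: (y1 l) (y2 l).
        by case: ifP => // _; case: ifP => // _ /andP[_ ->] /andP[->].
      move=> y1; split=> l; move: (y1 l); case: ifP => // _; case: ifP => // _ /andP[yv vy].
        by rewrite vy (le_trans uv).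
      by rewrite yv (le_trans vy).
    + by apply: liftable_sub liftd; apply: mid_sub; rewrite ge_min lexx.
    + by apply: liftable_sub lifte; apply: mid_sub; rewrite ge_min lexx orbT.
  apply: liftable_sub => y yP.
  have [yv|vy] := leP (y ord0 k') v; [left|right] => l; move: (yP l);
    case: ifP => // _; case: eqP => // -> /andP[yl yh].
    by rewrite yl.
  by rewrite yh (ltW vy).
- move=> r; have [d d0 liftd] := IH (ltnW kn) (fun l => if l == k' then r else x l).
  exists d => // u v ru uv vr; exists d => //.
  apply: liftable_sub liftd => y yP l; have := yP l.
  case: ifP => // _; case: ifP => // _ /andP[yu yv].
  by rewrite (le_trans ru) ?(le_trans yv).
exists d => //; apply: liftable_sub lift => y yP l; have := yP l.
rewrite ltnS leq_eqVlt -val_eqE /=; case: ltngtP => //= lk.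
by have -> : l = k' by apply: val_inj.
Qed.

Lemma simplex_lift n (s : continuousType (Delta R n) X) :
  exists s' : continuousType (Delta R n) Y, forall t, p (s' t) = s t.
Proof.
have [||g [cg gP]] := @liftable_box n.+1 (s \o @simplex_retract R n) (fun=> 0) (fun=> 1).
- move=> x; apply: continuous_comp; first exact: simplex_retract_continuous.
  exact: cts_fun.
- by move=> _; exact: ler01.
have c : continuous (g \o @set_val _ (@simplex R n)).
  apply: continuous_comp_within cg _ (@delta_box R n).
  exact: initial_continuous.
exists (mkcts c : continuousType _ _) => t.
by have := gP _ (delta_box t); rewrite /comp simplex_retractK.
Qed.

Lemma simplex_lifts_differ n (s s' : continuousType (Delta R n) Y) :
  (forall t, p (s t) = p (s' t)) -> exists b, forall t, a b (s t) = s' t.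
Proof.
move=> ss'; have [|||b bP] := @lifts_differ_by_deck _ setT s s' (@delta_connected R n).
- by apply: continuous_subspaceT; exact: cts_fun.
- by apply: continuous_subspaceT; exact: cts_fun.
- by move=> t _; exact: ss'.
- by exists b => t; exact: bP.
Qed.

End Covering.

(** * Paths *)

Section Push.
Variable R : realType.

Lemma push_comp l m n (f : 'I_m.+1 -> 'I_n.+1) (g : 'I_l.+1 -> 'I_m.+1)
  (t : Delta R l) : push f (push g t) = push (f \o g) t.
Proof.
apply: delta_ext => j; rewrite /= !mxE.
rewrite [RHS](partition_big g (fun i => f i == j)) //=.
apply: eq_bigr => i /eqP fi; rewrite mxE; apply: eq_bigl => k.
by apply/idP/andP => [/eqP gk|[]//]; rewrite gk fi.
Qed.

Lemma push_id n (f : 'I_n.+1 -> 'I_n.+1) (t : Delta R n) : f =1 id -> push f t = t.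
Proof.
move=> fE; apply: delta_ext => j; rewrite /= mxE (bigD1 j) ?fE //=.
by rewrite big1 ?addr0 // => i; rewrite fE => /andP[/eqP->]; rewrite eqxx.
Qed.

Lemma eq_push m n (f g : 'I_m.+1 -> 'I_n.+1) (t : Delta R m) :
  f =1 g -> push f t = push g t.
Proof.
by move=> fg; apply: delta_ext => j; rewrite /= !mxE; apply: eq_bigl => i; rewrite fg.
Qed.

Lemma push_vertex m n (f : 'I_m.+1 -> 'I_n.+1) i :
  push f (vertex R i) = vertex R (f i).
Proof.
apply: delta_ext => j; rewrite /= !mxE eqxx /= eq_sym.
case: eqP => fij.
  rewrite (bigD1 i) ?fij //= mxE !eqxx big1 ?addr0 // => k /andP[_ /negbTE ki].
  by rewrite mxE ki andbF.
rewrite big1 // => k fk; rewrite mxE eqxx /=; case: eqP => // ki.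
by case: fij; rewrite -ki (eqP fk).
Qed.

Lemma push_const m n (j : 'I_n.+1) (t : Delta R m) :
  push (fun=> j) t = vertex R j.
Proof.
apply: delta_ext => k; rewrite /= !mxE eqxx /= eq_sym.
case: eqP => _; last by rewrite big_pred0_eq.
exact: (deltaP t).2.
Qed.

Lemma push_injE m n (f : 'I_m.+1 -> 'I_n.+1) (t : Delta R m) i :
  injective f -> set_val (push f t) ord0 (f i) = set_val t ord0 i.
Proof.
move=> injf; rewrite /= mxE (bigD1 i) //= big1 ?addr0 // => k.
by move=> /andP[/eqP/injf->]; rewrite eqxx.
Qed.

Lemma push_out m n (f : 'I_m.+1 -> 'I_n.+1) (t : Delta R m) j :
  (forall i, f i != j) -> set_val (push f t) ord0 j = 0.
Proof. by move=> fj; rewrite /= mxE big1 // => i; rewrite (negbTE (fj i)). Qed.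

Lemma pull_vertex (X : topologicalType) m n (f : 'I_m.+1 -> 'I_n.+1)
  (s : sing R X n) i : pull f s (vertex R i) = s (vertex R (f i)).
Proof. by rewrite /pull /= push_vertex. Qed.

End Push.

Section Paths.
Variable R : realType.

(** Retracting makes this a point of the edge for every real r, not only for r
    between 0 and 1. *)
Definition edge_pt (r : R) : Delta R 1 :=
  simplex_retract (\row_j (if j == ord0 then 1 - r else r)).

Lemma edge_pt_continuous : continuous edge_pt.
Proof.
have c : continuous (fun r : R => \row_(j < 2) (if j == ord0 then 1 - r else r)).
  apply: continuous_rV => j; under eq_fun do rewrite mxE.
  case: eqP => _; last by move=> r; exact: cvg_id.
  by apply: continuous_subr; [exact: cst_continuous|move=> r; exact: cvg_id].
move=> r; apply: continuous_comp; [exact: c|exact: simplex_retract_continuous].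
Qed.

Lemma delta1_sum (t : Delta R 1) :
  set_val t ord0 ord0 = 1 - set_val t ord0 ord_max.
Proof.
have := (deltaP t).2; rewrite big_ord_recl big_ord1 => <-.
by rewrite (_ : fintype.lift ord0 ord0 = ord_max) ?addrK //; exact: val_inj.
Qed.

Lemma edge_ptK (t : Delta R 1) : edge_pt (set_val t ord0 ord_max) = t.
Proof.
rewrite /edge_pt (_ : \row_j _ = set_val t) ?simplex_retractK //.
apply/rowP => j; rewrite mxE; case: eqP => [->|j0]; first by rewrite delta1_sum.
have -> // : j = ord_max.
by case: j j0 => -[|[|[]]] // jlt j0; [case: j0|]; exact: val_inj.
Qed.

Lemma vertexE n (i j : 'I_n.+1) : set_val (vertex R i) ord0 j = (j == i)%:R.
Proof. by rewrite /= mxE eqxx. Qed.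

Lemma edge_pt0 : edge_pt 0 = vertex R ord0.
Proof. by rewrite -(edge_ptK (vertex R ord0)) vertexE. Qed.

Lemma edge_pt1 : edge_pt 1 = vertex R ord_max.
Proof. by rewrite -(edge_ptK (vertex R ord_max)) vertexE eqxx. Qed.

Variable X : topologicalType.
Implicit Types s : sing R X 1.

Local Notation e0 := (vertex R (ord0 : 'I_2)).
Local Notation e1 := (vertex R (ord_max : 'I_2)).

(** The projection of the 2-simplex onto its edges 01 and 12 along the direction
    of the edge 02, followed by the paths s and s'. *)
Definition horn_fun s s' (t : Delta R 2) : X :=
  if 0 <= set_val t ord0 ord0 - set_val t ord0 ord_max
  then s (edge_pt (1 - (set_val t ord0 ord0 - set_val t ord0 ord_max)))
  else s' (edge_pt (set_val t ord0 ord_max - set_val t ord0 ord0)).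

Lemma horn_fun_continuous s s' : s e1 = s' e0 -> continuous (horn_fun s s').
Proof.
move=> ss'.
have cd : continuous (fun t : Delta R 2 => set_val t ord0 ord0 - set_val t ord0 ord_max).
  by apply: continuous_subr; exact: continuous_delta_coord.
have c (f : sing R X 1) (h : Delta R 2 -> R) : continuous h ->
    continuous (fun t => f (edge_pt (h t))).
  move=> ch t; apply: (@continuous_comp _ _ _ (edge_pt \o h) f); last exact: cts_fun.
  by apply: continuous_comp; [exact: ch|exact: edge_pt_continuous].
apply: continuous_if => //.
- apply: c; apply: continuous_subr => //; exact: cst_continuous.
- by apply: c; apply: continuous_subr; exact: continuous_delta_coord.
- move=> t t0; rewrite t0 subr0 edge_pt1 ss'.
  by rewrite -opprB t0 oppr0 edge_pt0.
Qed.

Lemma horn_filler s s' : s e1 = s' e0 -> exists h : sing R X 2,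
  [/\ face (inord 2) h = s, face ord0 h = s' &
      forall t, range s (h t) \/ range s' (h t)].
Proof.
move=> ss'; exists (mkcts (horn_fun_continuous ss') : continuousType _ _); split.
- apply/continuousEP => t.
  change (horn_fun s s' (push (fintype.lift (inord 2 : 'I_3)) t) = s t).
  rewrite /horn_fun.
  have -> : set_val (push (fintype.lift (inord 2 : 'I_3)) t) ord0 ord_max = 0.
    apply: push_out => i; rewrite eq_sym.
    by rewrite (_ : ord_max = inord 2) ?neq_lift //; apply: val_inj; rewrite /= inordK.
  have -> : set_val (push (fintype.lift (inord 2 : 'I_3)) t) ord0 ord0 =
      set_val t ord0 ord0.
    rewrite -[RHS](push_injE _ _ (@lift_inj _ (inord 2 : 'I_3))).
    rewrite (_ : fintype.lift _ _ = ord0) //.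
    by apply: val_inj; rewrite /= /bump inordK.
  rewrite subr0 (deltaP t).1 delta1_sum opprB addrC subrK.
  by rewrite edge_ptK.
- apply/continuousEP => t.
  change (horn_fun s s' (push (fintype.lift (ord0 : 'I_3)) t) = s' t).
  rewrite /horn_fun.
  have -> : set_val (push (fintype.lift (ord0 : 'I_3)) t) ord0 ord0 = 0.
    exact: push_out.
  have -> : set_val (push (fintype.lift (ord0 : 'I_3)) t) ord0 ord_max =
      set_val t ord0 ord_max.
    rewrite -[RHS](push_injE _ _ (@lift_inj _ (ord0 : 'I_3))).
    by rewrite (_ : fintype.lift _ _ = ord_max) //; exact: val_inj.
  rewrite subr0 sub0r oppr_ge0; case: ifP => [t0|_]; last by rewrite edge_ptK.
  have t00 : set_val t ord0 ord_max = 0.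
    by apply: le_anti; rewrite t0 (deltaP t).1.
  by rewrite t00 oppr0 subr0 edge_pt1 ss' -(edge_ptK t) t00 edge_pt0.
- move=> t; change (range s (horn_fun s s' t) \/ range s' (horn_fun s s' t)).
  rewrite /horn_fun; case: ifP => _; [left|right].
    by exists (edge_pt (1 - (set_val t ord0 ord0 - set_val t ord0 ord_max))).
  by exists (edge_pt (set_val t ord0 ord_max - set_val t ord0 ord0)).
Qed.

Definition inverse_path s : sing R X 1 :=
  pull (fun i : 'I_2 => if i == ord0 then ord_max else ord0) s.

Definition const_path (x : X) : sing R X 1 := cst x.

(** The edge 02 of a 2-simplex with edges s and s'; junk if s does not end where
    s' starts.  Concatenating through a 2-simplex makes functoriality of the
    transport and additivity in homology immediate. *)
Definition concat s s' : sing R X 1 :=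
  match pselect (s e1 = s' e0) with
  | left ss' => face (inord 1) (projT1 (cid (horn_filler ss')))
  | right _ => s
  end.

Lemma concatP s s' : s e1 = s' e0 -> exists h : sing R X 2,
  [/\ face (inord 2) h = s, face ord0 h = s' & face (inord 1) h = concat s s'].
Proof.
move=> ss'; rewrite /concat; case: pselect => // H.
by case: cid => h [h2 h0 _] /=; exists h.
Qed.

Lemma concat_range s s' t : s e1 = s' e0 ->
  range s (concat s s' t) \/ range s' (concat s s' t).
Proof.
move=> ss'; rewrite /concat; case: pselect => // H.
case: cid => h [h2 h0 hr] /=; exact: hr.
Qed.

Lemma concat0 s s' : s e1 = s' e0 -> concat s s' e0 = s e0.
Proof.
move=> ss'; rewrite /concat; case: pselect => // H.
case: cid => h [h2 h0 _] /=; rewrite -h2 /face !pull_vertex push_vertex.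
by apply: (congr1 (fun i => h (vertex R i))); apply: val_inj; rewrite /= /bump !inordK.
Qed.

Lemma concat1 s s' : s e1 = s' e0 -> concat s s' e1 = s' e1.
Proof.
move=> ss'; rewrite /concat; case: pselect => // H.
case: cid => h [h2 h0 _] /=; rewrite -h0 /face !pull_vertex push_vertex.
by apply: (congr1 (fun i => h (vertex R i))); apply: val_inj; rewrite /= /bump !inordK.
Qed.

Lemma inverse_path0 s : inverse_path s e0 = s e1.
Proof. by rewrite /inverse_path pull_vertex. Qed.

Lemma inverse_path1 s : inverse_path s e1 = s e0.
Proof. by rewrite /inverse_path pull_vertex. Qed.

Lemma inverse_pathP s : exists h : sing R X 2,
  [/\ face (inord 2) h = s, face ord0 h = inverse_path s &
      face (inord 1) h = const_path (s e0)].
Proof.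
pose f (i : 'I_3) : 'I_2 := if i == inord 1 then ord_max else ord0.
exists (pull f s); split; apply/continuousEP => t;
  rewrite /face /pull /= push_comp /=.
- apply: (congr1 s); apply: push_id => i; apply: val_inj.
  rewrite /f /= -val_eqE /= /bump !inordK //.
  by case: i => -[|[|[]]].
- apply: (congr1 s); apply: eq_push => i; apply: val_inj.
  by rewrite /f /= -!val_eqE /= /bump !inordK.
- apply: (congr1 s); rewrite -[RHS](push_const _ t); apply: eq_push => i; apply: val_inj.
  by rewrite /f /= -!val_eqE /= /bump !inordK //; case: i => -[|[|[]]].
Qed.

Lemma const_pathP x : exists h : sing R X 2, forall i, face i h = const_path x.
Proof.
exists (cst x : continuousType _ _) => i; exact/continuousEP.
Qed.

Definition path_in (U : set X) (x y : X) :=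
  exists s, [/\ s e0 = x, s e1 = y & forall t, U (s t)].

Lemma path_in_refl U x : U x -> path_in U x x.
Proof. by exists (const_path x). Qed.

Lemma path_in_sym U x y : path_in U x y -> path_in U y x.
Proof.
move=> [s [s0 s1 Us]]; exists (inverse_path s); rewrite inverse_path0 inverse_path1.
by split=> // t; exact: Us.
Qed.

Lemma path_in_trans U x y z : path_in U x y -> path_in U y z -> path_in U x z.
Proof.
move=> [s [s0 s1 Us]] [s' [s'0 s'1 Us']].
have ss' : s e1 = s' e0 by rewrite s1 s'0.
exists (concat s s'); rewrite concat0 // concat1 //; split=> // t.
by have [[u _ <-]|[u _ <-]] := concat_range t ss'.
Qed.

(** A space is locally path-connected if and only if the path components of its
    open subsets are open. *)
Definition locally_path_connected :=
  forall (U : set X) x, open U -> open [set y | path_in U x y].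

Lemma near_path_in x : locally_path_connected ->
  \forall y \near x, path_in setT x y.
Proof.
move=> lpc; apply: open_nbhs_nbhs; split; last exact: path_in_refl.
by apply: lpc; exact: openT.
Qed.

Lemma connected_path_connected :
  (forall x, \forall y \near x, path_in setT x y) ->
  connected [set: X] -> forall x y, path_in setT x y.
Proof.
move=> lpc cX x y.
suff <- : path_in setT x x = path_in setT x y by exact: path_in_refl.
apply: (connected_locally_constant (b := fun z => path_in setT x z) cX) => // z _.
apply: filterS (lpc z) => w zw _; apply/propext; split=> [xw|xz].
  by apply: path_in_trans xw _; exact: path_in_sym.
exact: path_in_trans zw.
Qed.

End Paths.

(** * Local path-connectedness *)

Section CWPaths.
Variable R : realType.

Lemma path_in_segment (X : topologicalType) n (D : set 'rV[R]_n)
    (f : 'rV[R]_n -> X) (U : set X) x y : {within D, continuous f} ->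
  (forall r, 0 <= r <= 1 -> D (segment x y r) /\ U (f (segment x y r))) ->
  path_in R U (f x) (f y).
Proof.
move=> cf DU.
have t01 (t : Delta R 1) : 0 <= set_val t ord0 ord_max <= 1.
  exact: (delta_box t ord_max).
pose seg (t : Delta R 1) := segment x y (set_val t ord0 ord_max).
have cseg : continuous seg.
  move=> t; apply: (@continuous_comp _ _ _ (fun t : Delta R 1 => set_val t ord0 ord_max)).
    exact: continuous_delta_coord.
  exact: continuous_segment.
have c := continuous_comp_within cf cseg (fun t => (DU _ (t01 t)).1).
exists (mkcts c : continuousType _ _); split=> [||t].
- change (f (seg (vertex R ord0)) = f x).
  by rewrite /seg vertexE /segment scale0r addr0.
- change (f (seg (vertex R ord_max)) = f y).
  by rewrite /seg vertexE eqxx /segment scale1r addrC subrK.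
- exact: (DU _ (t01 t)).2.
Qed.

Lemma disk_closed n : closed (@disk R n).
Proof.
rewrite (_ : @disk R n =
  (fun x : 'rV[R]_n => \sum_i x ord0 i ^+ 2) @^-1` [set r | r <= 1]) //.
apply: preimage_closed; last exact: closed_le.
move=> x _; apply: continuous_sumr => i _ {}x.
apply: (@continuous_comp _ _ _ (fun x : 'rV[R]_n => x ord0 i) (fun r => r ^+ 2)).
  exact: coord_continuous.
exact: exprn_continuous.
Qed.

Lemma disk_convex n (x y : 'rV[R]_n) r : 0 <= r <= 1 ->
  disk x -> disk y -> disk (segment x y r).
Proof.
move=> /andP[r0 r1] dx dy; rewrite /disk /=.
have r1' : 0 <= 1 - r by rewrite subr_ge0.
apply: (@le_trans _ _ (\sum_i ((1 - r) * x ord0 i ^+ 2 + r * y ord0 i ^+ 2))).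
  apply: ler_sum => i _; rewrite !mxE -subr_ge0.
  set a := x _ _; set b := y _ _.
  have -> : (1 - r) * a ^+ 2 + r * b ^+ 2 - (a + r * (b - a)) ^+ 2 =
    (1 - r) * r * (a - b) ^+ 2 by ring.
  by rewrite mulr_ge0 ?sqr_ge0 // mulr_ge0.
rewrite big_split /= -!mulr_sumr -[leRHS](subrK r) lerD //.
  by rewrite -[leRHS]mulr1 ler_wpM2l.
by rewrite -[leRHS]mulr1 ler_wpM2l.
Qed.

(** In the weak topology, openness is tested on the disks through the
    characteristic maps, and disks are convex: near a point of the disk, all
    points are joined to it by segments that stay in the preimage of U. *)
Lemma cw_locally_path_connected (X : topologicalType) (cw : cw_structure R X) :
  locally_path_connected R X.
Proof.
move=> U x0 oU; rewrite -[X in open X]setCK; apply: closed_openC.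
apply/(cw_weak cw) => n e z clz.
have dz : disk z by apply: disk_closed => B /clz[w [[dw _] Bw]]; exists w.
split=> // Pz.
have Uz : U (chmap e z) by have [s [_ <- Us]] := Pz; exact: Us.
have Unear : \forall w \near z, disk w -> U (chmap e w).
  have := (subspace_continuousP _ _).1 (@cw_continuous _ _ cw n e) z dz.
  by apply; exact: open_nbhs_nbhs.
have /nbhs_ballP[d /= d0 dU] := Unear.
have [w [[dw Pw] zw]] := clz _ (nbhsx_ballx z d d0).
apply: Pw; apply: path_in_trans Pz _.
apply: path_in_segment (@cw_continuous _ _ cw n e) _ => r r01.
have dseg := disk_convex r01 dz dw.
split=> //; apply: dU => //; split=> // i j; rewrite ord1.
have [_ /(_ ord0 j)] := zw; rewrite !mxE.
change (`|z ord0 j - w ord0 j| < d ->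
  `|z ord0 j - (z ord0 j + r * (w ord0 j - z ord0 j))| < d).
rewrite opprD addrA subrr sub0r normrN normrM distrC => zwd.
have /andP[r0 r1] := r01; rewrite (ger0_norm r0).
by apply: le_lt_trans zwd; rewrite ler_piMl.
Qed.

(** Paths of X inside the image of a sheet are carried to Y by the inverse of p
    on that sheet. *)
Lemma cover_locally_path_connected (X Y : topologicalType) (p : Y -> X) :
  covering_map p -> locally_path_connected R X ->
  forall y : Y, \forall z \near y, path_in R setT y z.
Proof.
move=> cov lpc y.
have [V [q [oV Vy opV qK [_ cq]]]] := sheet_section cov y.
have cp : continuous p by case: cov.
have oP := lpc _ (p y) opV.
have pVy : (p @` V) (p y) by exists y.
have near_pz : \forall z \near y, path_in R (p @` V) (p y) (p z).
  by apply: cp; apply: open_nbhs_nbhs; split=> //; exact: path_in_refl.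
have near_V : \forall z \near y, V z by exact: open_nbhs_nbhs.
near=> z.
have [s [s0 s1 sV]] : path_in R (p @` V) (p y) (p z) by near: z.
have Vz : V z by near: z.
have c := continuous_comp_within cq (@cts_fun _ _ s) sV.
exists (mkcts c : continuousType _ _); split=> //.
  by change (q (s (vertex R ord0)) = y); rewrite s0 qK ?inE.
by change (q (s (vertex R ord_max)) = z); rewrite s1 qK ?inE.
Unshelve. all: by end_near. Qed.

End CWPaths.

(** * Chains with coefficients *)

Section FreeModule.
Variables (K : nzRingType) (T : choiceType).
Implicit Types D : {freeg T / K}.

Lemma freegZ (k l : K) x : k *: << l *g x >> = << k * l *g x >> :> {freeg T / K}.
Proof. by apply/eqP/freeg_eqP => y; rewrite coeffZ !coeffU mulrA. Qed.

Lemma freegE D : D = \sum_(x <- dom D) coeff x D *: << x >>.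
Proof.
rewrite -[LHS]freeg_sumE; apply: eq_bigr => x _.
by rewrite freegZ mulr1.
Qed.

Lemma fglift_linear (M : lmodType K) (f : T -> M) : linear (fglift f).
Proof.
have fB := @lift_is_additive K T M f.
have f0 : fglift f 0 = 0 by rewrite -(subrr (0 : {freeg T / K})) fB !subrr.
have fN D : fglift f (- D) = - fglift f D by rewrite -sub0r fB f0 sub0r.
have fD D D' : fglift f (D + D') = fglift f D + fglift f D'.
  by rewrite -{1}[D']opprK fB fN opprK.
move=> k u v; rewrite fD; congr (_ + _).
have key s (F : T -> K) : fglift f (k *: \sum_(x <- s) F x *: << x >>) =
    k *: fglift f (\sum_(x <- s) F x *: << x >>).
  rewrite scaler_sumr !(big_morph (fglift f) fD f0) scaler_sumr.
  by apply: eq_bigr => x _; rewrite !freegZ !liftU mulr1 scalerA.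
by have := key (dom u) (fun x => coeff x u); rewrite -freegE.
Qed.

HB.instance Definition _ (M : lmodType K) (f : T -> M) :=
  GRing.isLinear.Build K {freeg T / K} M _ (fglift f) (fglift_linear f).

Lemma fglift1 (M : lmodType K) (f : T -> M) x : fglift f << x >> = f x.
Proof. by rewrite liftU scale1r. Qed.

Lemma freeg_linear_ext (M : lmodType K) (f g : {linear {freeg T / K} -> M}) :
  (forall x, f << x >> = g << x >>) -> f =1 g.
Proof.
move=> fg D; rewrite (freegE D) !linear_sum; apply: eq_bigr => x _.
by rewrite !linearZ /= fg.
Qed.

End FreeModule.

Section Boundary.
Variables (R : realType) (X : topologicalType) (K : comNzRingType).
Variable w : sing R X 1 -> K.

Lemma bd_linear n : linear (@bd R X K w n).
Proof. exact: fglift_linear. Qed.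

HB.instance Definition _ n :=
  GRing.isLinear.Build K (chain R X K n.+1) (chain R X K n) _ (@bd R X K w n) (@bd_linear n).

Lemma bdE n (s : sing R X n.+1) : bd w << s >> = \sum_(i < n.+2)
    << (if i == ord0 then w (edge01 s) else 1) * (-1) ^+ i *g face i s >>
    :> chain R X K n.
Proof. exact: fglift1. Qed.

Lemma bd_simplex n (s : sing R X n.+1) : bd w << s >> =
  w (edge01 s) *: << face ord0 s >> +
  \sum_(i < n.+1) (-1) ^+ i.+1 *: << face (fintype.lift ord0 i) s >>
    :> chain R X K n.
Proof.
rewrite bdE big_ord_recl /= expr0 mulr1; congr (_ + _).
  by rewrite freegZ mulr1.
by apply: eq_bigr => i _; rewrite mul1r freegZ mulr1.
Qed.

End Boundary.

Section BoundarySquare.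
Variables (R : realType) (X : topologicalType) (K : comNzRingType).
Local Notation d := (bd (fun=> 1 : K)).

Lemma bd1E n (s : sing R X n.+1) :
  d << s >> = \sum_(i < n.+2) (-1) ^+ i *: << face i s >> :> chain R X K n.
Proof.
by rewrite bdE; apply: eq_bigr => i _; rewrite if_same mul1r freegZ mulr1.
Qed.

Lemma face_face n (s : sing R X n.+2) (i : 'I_n.+3) (j : 'I_n.+2) :
  (j < i)%N -> face j (face i s) =
    face (inord i.-1) (face (inord j) s).
Proof.
move=> ji; apply/continuousEP => t; rewrite /face /pull /= !push_comp.
apply: (congr1 s); apply: eq_push => l; apply: val_inj => /=.
have in1 : (i.-1 < n.+2)%N by case: i ji => -[].
rewrite /bump !inordK //; last by rewrite ltnS ltnW.
by move: ji; clear; case: i => -[|i] //= _; rewrite ltnS;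
  case: (leqP j l); case: (leqP i l); lia.
Qed.

(** The bijection (i, j) -> (j + 1, i) sends the pairs with i <= j to those with
    j < i, and the corresponding terms have opposite signs. *)
Lemma bd_bd n (c : chain R X K n.+2) : d (d c) = 0.
Proof.
suff dd s : d (d << s >>) = 0 :> chain R X K n.
  by rewrite (freegE c) !linear_sum big1 // => x _; rewrite !linearZ /= dd scaler0.
rewrite bd1E linear_sum.
under eq_bigr => i _ do rewrite linearZ /= bd1E scaler_sumr.
rewrite pair_big /= (bigID (fun p : 'I_n.+3 * 'I_n.+2 => (p.2 < p.1)%N)) /=.
apply/eqP; rewrite addrC addr_eq0 -sumrN; apply/eqP.
pose h (p : 'I_n.+3 * 'I_n.+2) : 'I_n.+3 * 'I_n.+2 := (inord p.2, inord p.1.-1).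
pose h' (p : 'I_n.+3 * 'I_n.+2) : 'I_n.+3 * 'I_n.+2 := (inord p.2.+1, inord p.1).
rewrite (reindex_onto h h') /=; last first.
  move=> [i j] /=; rewrite -leqNgt => ij; have jn := ltn_ord j.
  by congr pair; apply: val_inj; rewrite /= !inordK //= ?inordK //; lia.
apply: eq_big => [[i j]|[i j]] /=.
  have jn := ltn_ord j; have i_n := ltn_ord i.
  rewrite -leqNgt -pair_eqE /= -!val_eqE /=.
  by case: (ltnP j i) => ji; rewrite !inordK //; lia.
have jn := ltn_ord j; have i_n := ltn_ord i.
rewrite -leqNgt => /andP[ij /eqP[/(congr1 val) /= hi /(congr1 val) /= hj]].
have ji : (j < i)%N by move: ij hi; rewrite !inordK //; lia.
rewrite (face_face _ ji) !scalerA -scaleNr; congr (_ *: _).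
rewrite !inordK; [|lia..].
rewrite -!exprD -[in RHS](prednK (leq_ltn_trans (leq0n j) ji)) addSn exprS.
by rewrite mulN1r opprK addnC.
Qed.

End BoundarySquare.

(** * Transport along paths, and loops in homology *)

Section Transport.
Variables (R : realType) (X : topologicalType) (K : fieldType).
Variable w : sing R X 1 -> K.
Hypothesis w_neq0 : forall s, w s != 0.
Hypothesis w_functorial : forall s : sing R X 2,
  w (face (inord 1) s) = w (face (inord 2) s) * w (face ord0 s).

Local Notation e0 := (vertex R (ord0 : 'I_2)).
Local Notation e1 := (vertex R (ord_max : 'I_2)).

Lemma transport_const x : w (const_path R x) = 1.
Proof.
have [h hP] := const_pathP R x; have := w_functorial h; rewrite !hP => /esym/eqP.
rewrite -subr_eq0 -[X in _ - X]mulr1 -mulrBr mulf_eq0 (negbTE (w_neq0 _)).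
by rewrite subr_eq0 => /eqP.
Qed.

Lemma transport_concat (s s' : sing R X 1) : s e1 = s' e0 -> w (concat s s') = w s * w s'.
Proof.
by move=> /concatP[h [h2 h0 h1]]; have := w_functorial h; rewrite h2 h0 h1.
Qed.

Lemma transport_inverse (s : sing R X 1) : w (inverse_path s) = (w s)^-1.
Proof.
have [h [h2 h0 h1]] := inverse_pathP s; have := w_functorial h.
by rewrite h2 h0 h1 transport_const => E; apply: (mulfI (w_neq0 s)); rewrite divff.
Qed.

End Transport.

Section LoopsGenerate.
Variables (R : realType) (X : topologicalType).
Local Notation C1 := (chain R X int 1).
Local Notation d := (bd (fun=> 1 : int)).
Local Notation e0 := (vertex R (ord0 : 'I_2)).
Local Notation e1 := (vertex R (ord_max : 'I_2)).

Lemma cycles1P (c : C1) : (c \in @cycles1 R X) <-> d c = 0.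
Proof. by rewrite unfold_in /cycles1; split=> /eqP. Qed.

Lemma H1classB (c c' : C1) : d c = 0 -> d c' = 0 ->
  H1class (c - c') = H1class c - H1class c'.
Proof.
move=> /cycles1P cc /cycles1P cc'.
have cd : c - c' \in @cycles1 R X by rewrite rpredB.
rewrite /H1class -raddfB; congr (\pi_(_) _)%qT.
by apply: val_inj; rewrite raddfB /= !val_insubd cc cc' cd.
Qed.

Lemma H1class_eq (c c' : C1) : d c = 0 -> d c' = 0 ->
  boundaries (fun=> 1) (c - c') -> H1class c = H1class c'.
Proof.
move=> /cycles1P cc /cycles1P cc' bcc'; apply/eqP.
rewrite /H1class -Quotient.idealrBE unfold_in; apply/asboolP.
by rewrite raddfB /= !val_insubd cc cc'.
Qed.

Lemma bd_path (s : sing R X 1) :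
  d << s >> = << face ord0 s >> - << face ord_max s >> :> chain R X int 0.
Proof.
rewrite bd1E !big_ord_recl big_ord0 /= expr0 scale1r addr0 scaleN1r.
by congr (_ - << face _ s >>); exact: val_inj.
Qed.

Lemma bd_triangle (s : sing R X 2) :
  d << s >> = << face ord0 s >> - << face (inord 1) s >> + << face (inord 2) s >> :> C1.
Proof.
rewrite bd1E !big_ord_recl big_ord0 /= expr0 expr1 scale1r scaleN1r expr2.
rewrite mulrNN mul1r scale1r addr0 addrA.
by congr (_ - << face _ s >> + << face _ s >>); apply: val_inj; rewrite /= inordK.
Qed.

Lemma face_path (s : sing R X 1) (i : 'I_2) :
  face i s = cst (s (vertex R (fintype.lift i ord0))) :> sing R X 0.
Proof.
apply/continuousEP => t; rewrite /face /pull /=; apply: (congr1 s).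
rewrite -push_vertex; congr push; apply: delta_ext => j; rewrite vertexE (ord1 j) eqxx.
by rewrite -[RHS](deltaP t).2 big_ord1.
Qed.

Lemma bd_path_endpoints (s : sing R X 1) :
  d << s >> = << cst (s e1) : sing R X 0 >> - << cst (s e0) : sing R X 0 >>.
Proof.
rewrite bd_path !face_path; congr (<< cst (s (vertex R _)) : sing R X 0 >> -
  << cst (s (vertex R _)) : sing R X 0 >>); exact: val_inj.
Qed.

(** Joining the end points of each edge to a base point turns the edge into a
    loop, and changes a chain by the image of its boundary under a homomorphism;
    hence it does not change a cycle. *)
Lemma loops_generate_H1 (G : set (H1 R X)) (x0 : X) :
  (forall x, path_in R setT x0 x) -> subgroup G ->
  (forall x gamma, loop_at x gamma -> G (H1class << gamma >>)) ->
  forall h, G h.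
Proof.
move=> /choice[pi piP] sG Gloop h.
have pi0 x : pi x e0 = x0 by case: (piP x).
have pi1 x : pi x e1 = x by case: (piP x).
pose Pi : chain R X int 0 -> C1 :=
  fglift (fun s : sing R X 0 => << pi (s (vertex R ord0)) >>).
pose kappa (c : C1) : C1 := c - Pi (d c).
pose G' := [set c : C1 | d c = 0 /\ G (H1class c)].
have sG' : subgroup G'.
  split=> [|c c' [dc Gc] [dc' Gc']].
    have d0 : d 0 = 0 :> chain R X int 0 by rewrite linear0.
    by split=> //; rewrite -(subrr 0) H1classB // subrr; exact: sG.1.
  by split; rewrite ?linearB /= ?dc ?dc' ?subrr // H1classB //; exact: sG.2.
suff Gkappa c : G' (kappa c).
  have [z dz <-] : exists2 z : C1, d z = 0 & H1class z = h.
    exists (val (repr h)); first by apply/cycles1P; exact: valP.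
    by rewrite /H1class valKd reprK.
  by have := Gkappa z; rewrite /kappa dz /Pi linear0 subr0 => -[].
have kappa_edge (e : sing R X 1) :
    kappa << e >> = << e >> - << pi (e e1) >> + << pi (e e0) >>.
  by rewrite /kappa bd_path_endpoints /Pi linearB /= !fglift1 opprB addrAC addrA.
suff Gedge (e : sing R X 1) : G' (kappa << e >>).
  rewrite (freegE c) /kappa /Pi !linear_sum -big_split /=.
  apply: (big_ind G') => [|u v|e _]; [exact: sG'.1|exact: subgroupD|].
  rewrite !linearZ /= -scalerDr -[coeff e c]intz scaler_int.
  exact: (subgroupMz _ sG' (Gedge e)).
have dkappa : d (kappa << e >>) = 0.
  rewrite kappa_edge linearD linearB /= !bd_path_endpoints !pi0 !pi1.
  by rewrite opprB [X in X + _]addrC !subrKA subrr.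
pose c1 := concat (pi (e e0)) e; pose loop := concat c1 (inverse_path (pi (e e1))).
have pe : pi (e e0) e1 = e e0 by [].
have ce : c1 e1 = inverse_path (pi (e e1)) e0 by rewrite concat1 // inverse_path0 pi1.
have loop_x0 : loop_at x0 loop.
  by split; rewrite /loop; [rewrite !concat0|rewrite concat1 // inverse_path1].
have dloop : d << loop >> = 0.
  by rewrite bd_path_endpoints loop_x0.1 loop_x0.2 subrr.
split=> //; rewrite (H1class_eq dkappa dloop); first exact: Gloop loop_x0.
have [h1 [h12 h10 h11]] := concatP pe.
have [h2 [h22 h20 h21]] := concatP ce.
have [h3 [h32 h30 h31]] := inverse_pathP (pi (e e1)).
have [h4 h4P] := const_pathP R (pi (e e1) e0).
exists (<< h1 >> + << h2 >> - << h3 >> - << h4 >>) => //.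
rewrite !linearB linearD /= !bd_triangle h12 h10 h11 h22 h20 h21 h32 h30 h31 !h4P.
rewrite kappa_edge -/c1 -/loop.
by apply/eqP/freeg_eqP => x; rewrite !(coeffB, coeffD); ring.
Qed.

End LoopsGenerate.

(** * Homology of the base from homology of the cover *)

Section Transfer.
Variables (R : realType) (X Y : topologicalType) (A : zmodType) (K : fieldType).
Variables (p : continuousType Y X) (a : A -> Y -> Y).
Hypotheses (cov : covering_map p) (deck : regular_deck_action p a).
Local Notation CY n := (chain R Y K n).
Local Notation CX n := (chain R X K n).
Local Notation d := (bd (fun=> 1 : K)).
Local Notation dY n := (@bd R Y K (fun=> 1) n).

Definition translate n (b : A) (s : sing R Y n) : sing R Y n :=
  (mkcts (@deck_continuous _ _ _ _ _ deck b) : continuousType _ _) \o s.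

Lemma translateE n b (s : sing R Y n) t : translate b s t = a b (s t).
Proof. by []. Qed.

Lemma translate0 n (s : sing R Y n) : translate 0 s = s.
Proof. by apply/continuousEP => t; rewrite translateE (deck0 deck). Qed.

Lemma translateD n b c (s : sing R Y n) :
  translate (b + c) s = translate b (translate c s).
Proof. by apply/continuousEP => t; rewrite !translateE (deckD deck). Qed.

Definition act n (b : A) : CY n -> CY n := fglift (fun s => << translate b s >>).

HB.instance Definition _ n b := GRing.Linear.on (@act n b).

Lemma act1 n b (s : sing R Y n) : act b << s >> = << translate b s >>.
Proof. exact: fglift1. Qed.

Lemma act0 n (c : CY n) : act 0 c = c.
Proof.
by apply: (@freeg_linear_ext _ _ _ (@act n 0) idfun) => s; rewrite /= act1 translate0.
Qed.

Lemma actD n b b' (c : CY n) : act (b + b') c = act b (act b' c).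
Proof.
apply: (@freeg_linear_ext _ _ _ (@act n (b + b')) (@act n b \o @act n b')) => s.
by rewrite /= !act1 translateD.
Qed.

Lemma bd_act n b (c : CY n.+1) : d (act b c) = act b (d c).
Proof.
apply: (@freeg_linear_ext _ _ _ (dY n \o @act n.+1 b) (@act n b \o dY n)) => s.
rewrite /= act1 !bd1E linear_sum; apply: eq_bigr => i _.
by rewrite linearZ /= act1; congr (_ *: << _ >>); exact/continuousEP.
Qed.

Definition project n (s : sing R Y n) : sing R X n := p \o s.

Lemma project_translate n b (s : sing R Y n) :
  project (translate b s) = project s.
Proof. by apply/continuousEP => t; exact: (deckp deck). Qed.

Lemma choose_lift n : exists L : sing R X n -> sing R Y n, cancel L (@project n).
Proof.
have /choice[L LP] (s : sing R X n) := simplex_lift cov deck s.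
by exists L => s; apply/continuousEP => t; exact: LP.
Qed.

Lemma choose_deck n (L : sing R X n -> sing R Y n) : cancel L (@project n) ->
  exists D : sing R Y n -> A, forall s, translate (D s) (L (project s)) = s.
Proof.
move=> LK; have /choice[D DP] (s : sing R Y n) :
    exists b, translate b (L (project s)) = s.
  have [t|b bP] := simplex_lifts_differ cov deck (s := L (project s)) (s' := s).
    by have /continuousEP/(_ t) := LK (project s).
  by exists b; apply/continuousEP.
by exists D.
Qed.

Definition equivariant m n (f : CY m -> CY n) := forall b c, f (act b c) = act b (f c).

(** The chains of the cover are free over the group ring of A, with basis any
    choice of lifts of the simplices of the base: values there can be
    prescribed. *)
Lemma equivariant_extension m n (L : sing R X m -> sing R Y m)
    (f : sing R X m -> CY n) : cancel L (@project m) ->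
  exists2 g : {linear CY m -> CY n}, equivariant g &
    forall x, g << L x >> = f x.
Proof.
move=> LK; have [D DP] := choose_deck LK.
have Duniq s b : translate b (L (project s)) = s -> D s = b.
  move=> bs; have /continuousEP/(_ (vertex R ord0)) :
      translate (D s) (L (project s)) = translate b (L (project s)).
    by rewrite DP bs.
  by rewrite !translateE => /(deck_inj deck).
exists (fglift (fun s => act (D s) (f (project s)))).
  move=> b c; apply: (@freeg_linear_ext _ _ _ (fglift _ \o @act m b)
    (@act n b \o fglift _)) => s.
  rewrite /= act1 !fglift1 project_translate -actD; congr act.
  by apply: Duniq; rewrite project_translate translateD DP.
move=> x; rewrite /= fglift1 LK (Duniq _ 0) ?act0 //.
by rewrite LK translate0.
Qed.

(** An equivariant map is determined by its values on lifts, one for each simplex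
    of the base. *)
Lemma equivariant_eq m n (L : sing R X m -> sing R Y m)
    (g h : {linear CY m -> CY n}) : cancel L (@project m) ->
  equivariant g -> equivariant h ->
  (forall x, g << L x >> = h << L x >>) -> g =1 h.
Proof.
move=> LK eg eh gh; have [D DP] := choose_deck LK.
by apply: freeg_linear_ext => s; rewrite -(DP s) -act1 eg eh gh.
Qed.

Section PolynomialAction.
Variable b : A.

Definition poly_act n (q : {poly K}) : CY n -> CY n :=
  fglift (fun s => \sum_(k < size q) q`_k *: << translate (b *+ k) s >>).

HB.instance Definition _ n q := GRing.Linear.on (@poly_act n q).

Lemma poly_actE n q (c : CY n) :
  poly_act q c = \sum_(k < size q) q`_k *: act (b *+ k) c.
Proof.
rewrite (freegE c); move: (dom c) (fun s => coeff s c) => r F.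
rewrite linear_sum; under [RHS]eq_bigr => k _ do rewrite linear_sum scaler_sumr.
rewrite exchange_big /=; apply: eq_bigr => s _.
rewrite linearZ /= /poly_act fglift1 scaler_sumr; apply: eq_bigr => k _.
by rewrite [act _ _]linearZ /= act1 !scalerA mulrC.
Qed.

Lemma poly_act_equivariant n q : equivariant (@poly_act n q).
Proof.
move=> b' c; rewrite !poly_actE linear_sum; apply: eq_bigr => k _.
by rewrite linearZ /= -!actD addrC.
Qed.

Lemma bd_poly_act n q (c : CY n.+1) : d (poly_act q c) = poly_act q (d c).
Proof.
rewrite !poly_actE linear_sum; apply: eq_bigr => k _.
by rewrite linearZ /= bd_act.
Qed.

Lemma cycles_act n (c : CY n) : cycles (fun=> 1) c -> cycles (fun=> 1) (act b c).
Proof. by case: n c => [|n] c //= dc; rewrite bd_act dc linear0. Qed.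

Lemma boundaries_act n (c : CY n) :
  boundaries (fun=> 1) c -> boundaries (fun=> 1) (act b c).
Proof. by move=> [e _ <-]; exists (act b e) => //; rewrite bd_act. Qed.

Lemma boundariesD n (c c' : CY n) : boundaries (fun=> 1) c ->
  boundaries (fun=> 1) c' -> boundaries (fun=> 1) (c + c').
Proof. by move=> [e _ <-] [e' _ <-]; exists (e + e') => //; rewrite linearD. Qed.

Lemma boundariesZ n k (c : CY n) : boundaries (fun=> 1) c ->
  boundaries (fun=> 1) (k *: c).
Proof. by move=> [e _ <-]; exists (k *: e) => //; rewrite linearZ. Qed.

Lemma boundaries_sum n (I : Type) (r : seq I) (F : I -> CY n) :
  (forall l, boundaries (fun=> 1) (F l)) -> boundaries (fun=> 1) (\sum_(l <- r) F l).
Proof.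
move=> FB; apply: (big_ind (@boundaries R Y K (fun=> 1) n)) => //; last exact: boundariesD.
by exists 0 => //; rewrite linear0.
Qed.

(** By the Cayley-Hamilton theorem, the characteristic polynomial of a matrix
    giving the action of b on finitely many generators works. *)
Lemma annihilating_polynomial j : homology_finite_dim (fun=> 1 : K) (X := Y) (R := R) j ->
  exists2 q : {poly K}, q != 0 &
    forall c : CY j, cycles (fun=> 1) c -> boundaries (fun=> 1) (poly_act q c).
Proof.
move=> [n [z [zc zgen]]].
case: n z zc zgen => [|n] z zc zgen.
  exists 1; first exact: oner_neq0.
  move=> c /zgen[v]; rewrite big_ord0 subr0 poly_actE.
  by rewrite size_polyC oner_neq0 big_ord1 coefC eqxx scale1r mulr0n act0.
have /choice[m mP] l := zgen _ (cycles_act (zc l)).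
pose M : 'M[K]_n.+1 := \matrix_(l, k) m l k.
pose comb (v : 'rV[K]_n.+1) : CY j := \sum_l v ord0 l *: z l.
have combD v v' : comb (v + v') = comb v + comb v'.
  by rewrite -big_split; apply: eq_bigr => l _; rewrite mxE scalerDl.
have combZ k v : comb (k *: v) = k *: comb v.
  by rewrite scaler_sumr; apply: eq_bigr => l _; rewrite mxE scalerA.
have comb0 : comb 0 = 0 by rewrite -(scale0r 0) combZ scale0r.
have act_comb v : boundaries (fun=> 1) (act b (comb v) - comb (v *m M)).
  have -> : act b (comb v) - comb (v *m M) =
      \sum_l v ord0 l *: (act b (z l) - \sum_k m l k *: z k).
    under [RHS]eq_bigr => l _ do rewrite scalerBr.
    rewrite sumrB linear_sum; congr (_ - _).
      by apply: eq_bigr => l _; exact: linearZ.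
    under [RHS]eq_bigr => l _ do rewrite scaler_sumr.
    rewrite exchange_big; apply: eq_bigr => k _; rewrite mxE scaler_suml.
    by apply: eq_bigr => l _; rewrite mxE scalerA.
  by apply: boundaries_sum => l; apply: boundariesZ; exact: mP.
have actn_comb k v : boundaries (fun=> 1) (act (b *+ k) (comb v) - comb (v *m M ^+ k)).
  elim: k => [|k IH].
    rewrite mulr0n act0 expr0 mulmx1 subrr.
    by exists 0 => //; rewrite linear0.
  have -> : act (b *+ k.+1) (comb v) - comb (v *m M ^+ k.+1) =
      act b (act (b *+ k) (comb v) - comb (v *m M ^+ k)) +
      (act b (comb (v *m M ^+ k)) - comb (v *m M ^+ k *m M)).
    by rewrite mulrS actD linearB /= addrA subrK exprSr mulmxA.
  by apply: boundariesD; [exact: boundaries_act|exact: act_comb].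
pose q := char_poly M.
exists q; first exact/monic_neq0/char_poly_monic.
have q_comb v : boundaries (fun=> 1) (poly_act q (comb v)).
  have qM : \sum_(k < size q) q`_k *: M ^+ k = 0.
    have : horner_mx M (\sum_(k < size q) q`_k *: 'X^k) = 0.
      by rewrite -poly_def coefK Cayley_Hamilton.
    rewrite rmorph_sum => E; rewrite -[RHS]E.
    apply: eq_bigr => k _.
    by rewrite /= horner_mxZ rmorphXn /= horner_mx_X.
  have -> : poly_act q (comb v) =
      \sum_(k < size q) q`_k *: (act (b *+ k) (comb v) - comb (v *m M ^+ k)).
    under [RHS]eq_bigr => k _ do rewrite scalerBr -combZ.
    rewrite sumrB -poly_actE -(big_morph comb combD comb0).
    under eq_bigr => k _ do rewrite scalemxAr.
    by rewrite -mulmx_sumr qM mulmx0 comb0 subr0.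
  by apply: boundaries_sum => k; apply: boundariesZ; exact: actn_comb.
move=> c /zgen[v cv].
have -> : poly_act q c =
    poly_act q (c - \sum_l v l *: z l) + poly_act q (comb (\row_l v l)).
  rewrite -linearD; congr (poly_act q _); rewrite /comb.
  under [X in _ + X]eq_bigr => l _ do rewrite mxE.
  by rewrite subrK.
apply: boundariesD => //; case: cv => e _ <-.
by exists (poly_act q e) => //; rewrite bd_poly_act.
Qed.

End PolynomialAction.

Section Contraction.
Variables (w : sing R X 1 -> K) (u : Y -> K) (sigma : A -> K).
Hypothesis u_neq0 : forall y, u y != 0.
Hypothesis u_transport : forall s : sing R Y 1,
  u (s (vertex R ord_max)) = u (s (vertex R ord0)) * w (project s).
Hypothesis u_deck : forall b y, u (a b y) = sigma b * u y.

(** The factor u makes this a chain map to the complex of the local system w,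
    where coefficients are transported along the edge 01. *)
Definition transfer n : CY n -> CX n :=
  fglift (fun s : sing R Y n => u (s (vertex R ord0)) *: << project s >>).

HB.instance Definition _ n := GRing.Linear.on (@transfer n).

Lemma transfer1 n (s : sing R Y n) :
  transfer << s >> = u (s (vertex R ord0)) *: << project s >>.
Proof. exact: fglift1. Qed.

Lemma transfer_bd n (c : CY n.+1) : transfer (d c) = bd w (transfer c).
Proof.
apply: (@freeg_linear_ext _ _ _ (@transfer n \o dY n)
  (@bd R X K w n \o @transfer n.+1)) => s.
rewrite /= transfer1 linearZ /= !bd_simplex scale1r linearD linear_sum /=.
rewrite transfer1 scalerDr.
congr (_ + _).
  rewrite scalerA; congr (_ *: << _ >>); last exact/continuousEP.
  have pe : edge01 (project s) = project (edge01 s) by exact/continuousEP.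
  rewrite pe; have := u_transport (edge01 s); rewrite {1 2}/edge01 /face !pull_vertex.
  by rewrite (_ : widen_ord _ ord0 = ord0) => [<-|];
    [congr (u (s (vertex R _)))|]; exact: val_inj.
rewrite scaler_sumr; apply: eq_bigr => i _.
rewrite linearZ /= transfer1 !scalerA mulrC /face pull_vertex.
rewrite (_ : fintype.lift (fintype.lift ord0 i) ord0 = ord0); last exact: val_inj.
by congr (_ *: << _ >>); exact/continuousEP.
Qed.

Lemma transfer_act n b (c : CY n) : transfer (act b c) = sigma b *: transfer c.
Proof.
apply: (@freeg_linear_ext _ _ _ (@transfer n \o @act n b) (sigma b \*: @transfer n)) => s.
by rewrite /= act1 !transfer1 project_translate translateE u_deck scalerA.
Qed.

Lemma transfer_poly_act n b q (c : CY n) :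
  transfer (poly_act b q c) = q.[sigma b] *: transfer c.
Proof.
have sigmaM k : transfer (act (b *+ k) c) = sigma b ^+ k *: transfer c.
  elim: k => [|k IH]; first by rewrite mulr0n act0 expr0 scale1r.
  by rewrite mulrS actD transfer_act IH scalerA exprS.
rewrite poly_actE linear_sum horner_coef scaler_suml; apply: eq_bigr => k _.
by rewrite linearZ /= sigmaM scalerA.
Qed.

Lemma transfer_surjective n (z : CX n) : exists c : CY n, transfer c = z.
Proof.
have [L LK] := choose_lift n.
exists (fglift (fun x : sing R X _ => (u (L x (vertex R ord0)))^-1 *: << L x >>) z).
apply: (@freeg_linear_ext _ _ _ (@transfer n \o fglift _) idfun) => x.
by rewrite /= fglift1 linearZ /= transfer1 LK scalerA mulVf // scale1r.
Qed.

(** The transfer is a quotient map by the relations b s = sigma b s, which an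
    equivariant g preserves; S below is the map induced by g on the base. *)
Lemma transfer_kernel m n (g : {linear CY m -> CY n}) : equivariant g ->
  forall c, transfer c = 0 -> transfer (g c) = 0.
Proof.
move=> eg c c0.
have [L LK] := choose_lift m; have [D DP] := choose_deck LK.
pose S : CX m -> CX n :=
  fglift (fun x : sing R X _ => (u (L x (vertex R ord0)))^-1 *: transfer (g << L x >>)).
suff E e : transfer (g e) = S (transfer e) by rewrite E c0 /S linear0.
apply: (@freeg_linear_ext _ _ _ (@transfer n \o g) (fglift _ \o @transfer m)) => s.
rewrite /= transfer1 linearZ /= fglift1 scalerA.
set x := project s; rewrite -(DP s) -/x -act1 eg transfer_act translateE u_deck.
by rewrite mulfK.
Qed.

Section Homotopy.
Variable b : A.

(** Phi is homotopic to zero in degrees below m, through a homotopy of which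
    only the composite e = s d in degree m is kept (e = 0 if m = 0).  That
    Phi - e takes its values in the cycles is the homotopy relation in degree
    m - 1; the last two conditions retain that e factors through d. *)
Definition contracted m (Phi : forall n, {linear CY n -> CY n}) (l : K)
    (e : {linear CY m -> CY m}) :=
  [/\ [/\ forall n c, Phi n (d c) = d (Phi n.+1 c), forall n, equivariant (Phi n),
        forall n c, transfer (Phi n c) = l *: transfer c & l != 0],
      equivariant e,
      forall c, cycles (fun=> 1) (Phi m c - e c),
      forall c, boundaries (fun=> 1) c -> e c = 0 &
      forall c, cycles w (transfer c) -> transfer (e c) = 0].

(** On the lift of each simplex, Phi - e gives a cycle, which q turns into a
    boundary; the chosen primitives extend to an equivariant map s. *)
Lemma contraction_step m q Phi l (e : {linear CY m -> CY m}) : contracted Phi l e ->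
  (forall c : CY m, cycles (fun=> 1) c -> boundaries (fun=> 1) (poly_act b q c)) ->
  exists2 s : {linear CY m -> CY m.+1}, equivariant s &
    forall c, d (s c) = poly_act b q (Phi m c - e c).
Proof.
move=> [[_ ePhi _ _] ee cyc _ _] kill.
have [L LK] := choose_lift m.
have /choice[f fP] (x : sing R X m) :
    exists c, d c = poly_act b q (Phi m << L x >> - e << L x >>).
  by have [c _ <-] := kill _ (cyc << L x >>); exists c.
have [s es sf] := equivariant_extension f LK.
exists s => //; apply: (@equivariant_eq _ _ L (dY m \o s)
  (@poly_act b m q \o (Phi m \- e)) LK).
- by move=> b' c /=; rewrite es bd_act.
- by move=> b' c /=; rewrite ePhi ee -linearB poly_act_equivariant.
- by move=> x /=; rewrite sf fP.
Qed.

(** Each step composes Phi with the polynomial that kills the homology in one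
    more degree. *)
Lemma contraction m : (forall j, (j < m)%N -> exists2 q : {poly K},
    q.[sigma b] != 0 &
    forall c : CY j, cycles (fun=> 1) c -> boundaries (fun=> 1) (poly_act b q c)) ->
  exists Phi l (e : {linear CY m -> CY m}), contracted Phi l e.
Proof.
elim: m => [_|m IH kill].
  exists (fun n => idfun), 1, \0; split=> [|b' c|c|c _|c _] //=.
  - by split=> // *; rewrite ?scale1r ?oner_neq0.
  - by rewrite linear0.
  - by rewrite linear0.
have [j jm|Phi [l [e con]]] := IH; first by apply: kill; exact: ltnW.
have [q q0 qkill] := kill m (ltnSn m).
have [s es ds] := contraction_step con qkill.
have [[dPhi ePhi tPhi l0] ee cyc eb te] := con.
exists (fun n => @poly_act b n q \o Phi n), (q.[sigma b] * l), (s \o dY m).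
split=> [|b' c|c|c [c' _ <-]|c dc] /=.
- split=> [n c|n b' c|n c|].
  + by rewrite /= dPhi bd_poly_act.
  + by rewrite /= ePhi poly_act_equivariant.
  + by rewrite /= transfer_poly_act tPhi scalerA.
  + by rewrite mulf_neq0.
- by rewrite bd_act es.
- rewrite linearB /= ds bd_poly_act dPhi (eb (d c)); last by exists c.
  by rewrite subr0 subrr.
- by rewrite bd_bd linear0.
- by apply: transfer_kernel => //; rewrite transfer_bd.
Qed.

(** For a chain c that the transfer sends to a cycle of the local system, the
    relation d (s c) = q (Phi c - e c) becomes, on the base, that a nonzero
    multiple of this cycle is a boundary. *)
Lemma local_homology_vanishes j : (forall m, (m <= j)%N -> exists2 q : {poly K},
    q.[sigma b] != 0 &
    forall c : CY m, cycles (fun=> 1) c -> boundaries (fun=> 1) (poly_act b q c)) ->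
  ~ homology_neq0 w j.
Proof.
move=> kill [z cz]; apply.
have [m mj|Phi [l [e con]]] := @contraction j; first by apply: kill; exact: ltnW.
have [q q0 qkill] := kill j (leqnn j).
have [s es ds] := contraction_step con qkill.
have [[dPhi ePhi tPhi l0] ee cyc eb te] := con.
have [c cz'] := transfer_surjective z; subst z.
exists ((q.[sigma b] * l)^-1 *: transfer (s c)) => //.
rewrite linearZ /= -transfer_bd ds transfer_poly_act linearB /= tPhi te // subr0.
by rewrite !scalerA -mulrA mulVf ?scale1r // mulf_neq0.
Qed.

End Homotopy.

End Contraction.

End Transfer.

(** * Characters trivial on the cover *)

Section Trivialization.
Variables (R : realType) (X Y : topologicalType) (A : zmodType).
Variables (nu : {additive H1 R X -> A}) (p : continuousType Y X) (a : A -> Y -> Y).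
Variables (rho : character R[i] (H1 R X)) (w : sing R X 1 -> R[i]).
Hypotheses (deck : regular_deck_action p a) (det : determined_by nu p).
Hypotheses (local : is_local_system rho w) (rho1 : forall h, nu h = 0 -> rho h = 1).

Local Notation e0 := (vertex R (ord0 : 'I_2)).
Local Notation e1 := (vertex R (ord_max : 'I_2)).

Lemma path_homotopic_refl (s : sing R X 1) : path_homotopic s s.
Proof.
exists (s \o fst); split=> // t; apply: continuous_comp; first exact: cvg_fst.
exact: cts_fun.
Qed.

Lemma transport_cover_loop (s : sing R Y 1) : s e0 = s e1 -> w (project p s) = 1.
Proof.
move=> s01; have [_ _ wloop] := local.
have lp : loop_at (p (s e0)) (project p s) by split; rewrite //= s01.
rewrite (wloop _ _ lp); apply: rho1; apply/(det lp).
by exists s; [split|exact: path_homotopic_refl].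
Qed.

(** Transport from y0 is well defined on Y because loops of Y project to loops
    whose class is in the kernel of nu. *)
Lemma cover_trivializes (y0 : Y) : (forall y, path_in R setT y0 y) ->
  exists (u : Y -> R[i]) (sigma : A -> R[i]), [/\ forall y, u y != 0,
    forall s : sing R Y 1, u (s e1) = u (s e0) * w (project p s) &
    forall b y, u (a b y) = sigma b * u y].
Proof.
have [w0 wF _] := local.
move=> /choice[pi piP].
have pi0 y : pi y e0 = y0 by case: (piP y).
have pi1 y : pi y e1 = y by case: (piP y).
pose wY (s : sing R Y 1) := w (project p s).
have wY0 s : wY s != 0 by exact: w0.
have wYF (s : sing R Y 2) :
    wY (face (inord 1) s) = wY (face (inord 2) s) * wY (face ord0 s).
  have E i : project p (face i s) = face i (p \o s : sing R X 2) by exact/continuousEP.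
  by rewrite /wY !E wF.
pose u y := wY (pi y).
have uw (s : sing R Y 1) : u (s e1) = u (s e0) * wY s.
  have c1 : pi (s e0) e1 = s e0 by [].
  have c2 : concat (pi (s e0)) s e1 = inverse_path (pi (s e1)) e0.
    by rewrite concat1 // inverse_path0 pi1.
  have : wY (concat (concat (pi (s e0)) s) (inverse_path (pi (s e1)))) = 1.
    apply: transport_cover_loop.
    by rewrite concat0 // concat0 // concat1 // inverse_path1 !pi0.
  rewrite !(transport_concat wYF) // (transport_inverse wY0 wYF).
  by move/divr1_eq.
exists u, (fun b => u (a b y0)); split=> [y|s|b y]; [exact: wY0|exact: uw|].
have := uw (translate deck b (pi y)); rewrite !translateE pi0 pi1 => ->.
by rewrite /wY project_translate.
Qed.

End Trivialization.

Lemma epi_class_kernel (H A : zmodType) (nu nu' : {additive H -> A}) :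
  epi_class nu = epi_class nu' -> Defs.kernel nu = Defs.kernel nu'.
Proof.
move=> E; have : epi_class nu nu by exists idfun => //; exists idfun.
rewrite E => -[alpha /bij_inj alpha_inj nuE].
apply/seteqP; split=> x /=; rewrite /Defs.kernel /= nuE.
  by rewrite -{1}(raddf0 alpha) => /alpha_inj.
by move=> ->; rewrite raddf0.
Qed.

Lemma kernel_subgroup (H A : zmodType) (nu : {additive H -> A}) :
  subgroup (Defs.kernel nu).
Proof.
split; first exact: raddf0.
by move=> x y; rewrite /Defs.kernel /= raddfB => -> ->; rewrite subrr.
Qed.

Lemma common_nonroot (K : closedFieldType) i (P : nat -> {poly K} -> Prop) :
  (forall m, (m <= i)%N -> exists2 q, q != 0 & P m q) ->
  exists2 t : K, t != 0 & forall m, (m <= i)%N -> exists2 q, q.[t] != 0 & P m q.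
Proof.
move=> PE.
have /choice[q qP] m : exists q, (m <= i)%N -> q != 0 /\ P m q.
  have [/PE[q q0 Pq]|_] := boolP (m <= i)%N; first by exists q.
  by exists 0.
have : 'X * \prod_(m < i.+1) q m != 0.
  rewrite mulf_neq0 ?polyX_eq0 //; apply/prodf_neq0 => m _.
  by have [] := qP m (ltn_ord m).
move=> /closed_nonrootP[t]; rewrite rootM rootX negb_or => /andP[t0 tq].
exists t => // m mi; exists (q m); last by case: (qP m mi).
apply: contra tq => qm0.
rewrite -[m]/(val (Ordinal (mi : (m < i.+1)%N))) in qm0.
rewrite (bigD1 (Ordinal (mi : (m < i.+1)%N))) //= rootM.
by rewrite /root qm0.
Qed.

(** * The theorem *)

Theorem theorem3 (R : realType) (X : topologicalType) (cw : cw_structure R X)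
    (k i : nat) (A : zmodType) :
  [set: X] !=set0 -> connected [set: X] ->
  (1 <= k)%N -> finite_skeleton cw k -> (i <= k)%N ->
  (exists nu : {additive H1 R X -> A}, epi nu) ->
  Omega R X A i `<=`
    Gamma (H1 R X) A `\`
      \bigcup_(d in [set d | (1 <= d)%N])
        \bigcup_(xi in Xi d (V R X i)) U A R xi.
Proof.
move=> [x0 _] cX _ _ _ _ _ [nu [epi_nu [Y [p [[cY cov [a deck] det] fin]]]] <-].
split; first by exists nu.
move=> [d _ [xi [sxi _ [eta [etaq _] [_ etaV _]]] [nu' [_ rk ker] nuE]]].
have kerE := epi_class_kernel nuE; rewrite kerE in rk ker.
have lpc := cw_locally_path_connected cw.
have pcX := connected_path_connected (fun x => near_path_in x lpc) cX.
have pcY := connected_path_connected (cover_locally_path_connected cov lpc) cY.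
have sN := kernel_subgroup nu.
have sS := subgroup_sum_subgroup sN sxi.
have [x [gamma [lgamma hS]]] : exists x gamma, loop_at x gamma /\
    ~ pclosure (subgroup_sum (Defs.kernel nu) xi) (H1class << gamma >>).
  apply: contrapT => nloop.
  have all : pclosure (subgroup_sum (Defs.kernel nu) xi) = setT.
    apply/seteqP; split=> // h _; move: h.
    apply: (loops_generate_H1 (x0 := x0)) => //; first exact: pclosure_subgroup.
    move=> x gamma lg; apply: contrapT => ng; apply: nloop.
    by exists x, gamma.
  by have := pclosure_full_rank R all; rewrite leNgt rk.
(* b does not depend on the character chosen below *)
have [gamma' gammaE] := simplex_lift cov deck gamma.
have [g0 g1] := lgamma.
have [b bP] : exists b, a b (gamma' (vertex R ord0)) = gamma' (vertex R ord_max).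
  by apply: (deck_trans deck); rewrite !gammaE g0 g1.
have [t t0 tP] : exists2 t : R[i], t != 0 & forall m, (m <= i)%N ->
    exists2 q : {poly R[i]}, q.[t] != 0 & forall c : chain R Y R[i] m,
      cycles (fun=> 1) c -> boundaries (fun=> 1) (poly_act deck b q c).
  apply: common_nonroot => m mi.
  exact: (annihilating_polynomial deck b (fin m mi)).
have sxi' := pclosure_subgroup sxi.
have [||rho [rhoN rhoxi rhoh]] := character_glue (eta := eta)
  (h := H1class << gamma >>) sN sxi' _ _ t0.
- have [eta0 etaD eta1] := etaq; split=> // z Nz; apply: eta1; exact: ker.
- move=> m m0 [y [z [Ny [m' m'0 xiz] hE]]]; apply: hS.
  exists (m * m')%N; first by rewrite muln_gt0 m0.
  exists (y *+ m'), (z *+ m'); split=> //; first exact: subgroupMn.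
  by rewrite mulrnA hE mulrnDl.
have [j /andP[_ ji] [w local nz]] := etaV _ rhoxi.
have [u [sigma [u0 uw ua]]] := cover_trivializes deck det local rhoN
  (y0 := gamma' (vertex R ord0)) (pcY _).
have sigma_t : sigma b = t.
  have [_ _ wloop] := local.
  rewrite -rhoh -(wloop _ _ lgamma).
  have -> : gamma = project p gamma' by apply/continuousEP => z; rewrite /= gammaE.
  by have := uw gamma'; rewrite -bP ua mulrC => /(mulfI (u0 _)).
apply: (local_homology_vanishes cov u0 uw ua (b := b) _ nz) => m mj.
by rewrite sigma_t; apply: tP; exact: leq_trans mj ji.
Qed.
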